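(* Let $t \ge 2$ be an integer, let $j$ be an integer with $2 \le j \le \binom{t+1}{2}$, and let $a = \frac{j+1}{2j-1}$. Then, as $n \to \infty$, $$(1-o(1))\,n^{(2+2a)/3} \le \mathrm{ex}\left(n, n^a, \{C_4, \theta_{3,t}\}\right) \le \left(\sqrt[3]{t-1} + o(1)\right) n^{(2+2a)/3}.$$
   Context: For positive integers $n, m$ and a family $\mathcal{F}$ of graphs, the bipartite Turán number $\mathrm{ex}(n,m,\mathcal{F})$ is the maximum number of edges in a bipartite graph with parts of sizes $m$ and $n$ that contains no graph of $\mathcal{F}$ as a subgraph. $C_4$ is the cycle of length $4$, and $\theta_{k,t}$ is the graph consisting of two vertices joined by $t$ internally vertex-disjoint paths, each of length $k$. *)

(* Defs.v *)
From HB Require Import structures.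
From mathcomp Require Import all_boot all_order all_algebra.
From mathcomp Require Import all_classical all_reals all_analysis.

Set Implicit Arguments.
Unset Strict Implicit.
Unset Printing Implicit Defensive.

Import Order.TTheory GRing.Theory Num.Theory.
Import numFieldNormedType.Exports.

Record sgraph := SGraph {
  vertex :> finType;
  edge : rel vertex;
  edge_sym : symmetric edge;
  edge_irrefl : irreflexive edge
}.

Definition edge_set (G : sgraph) : {set {set G}} :=
  [set [set p.1; p.2] | p : G * G & edge p.1 p.2].

(* Not necessarily induced. *)
Definition subgraph (H G : sgraph) : Prop :=
  exists f : H -> G, injective f /\ forall x y, edge x y -> edge (f x) (f y).

Definition graph_free (F : sgraph -> Prop) (G : sgraph) : Prop :=
  forall H, F H -> ~ subgraph H G.

Definition bipartite (n m : nat) (G : sgraph) : Prop :=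
  exists A : {set G}, [/\ #|A| = n, #|~: A| = m &
    forall x y, edge x y -> (x \in A) != (y \in A)].

(* The set of possible edge numbers is bounded by n * m (see
   bipartite_card_edge_set); ex_bip n m F is 0 by convention if it is empty. *)
Definition ex_bip (n m : nat) (F : sgraph -> Prop) : nat :=
  \max_(k < (n * m).+1 | `[< exists G : sgraph,
      [/\ bipartite n m G, graph_free F G & #|edge_set G| = k] >]) k.

Lemma bipartite_card_edge_set n m (G : sgraph) :
  bipartite n m G -> #|edge_set G| <= n * m.
Proof.
case=> A [<- <- bipA]; rewrite -cardsX.
apply: leq_trans (leq_imset_card (fun p : G * G => [set p.1; p.2]) _).
apply/subset_leq_card/fintype.subsetP => e /imsetP[[x y]].
rewrite inE /= => xy ->.
have := bipA _ _ xy; case xA: (x \in A); case yA: (y \in A) => // _.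
  by apply/imsetP; exists (x, y); rewrite // finset.in_setX finset.in_setC xA yA.
apply/imsetP; exists (y, x); last exact: finset.setUC.
by rewrite finset.in_setX finset.in_setC xA yA.
Qed.

Lemma leq_ex_bip n m (F : sgraph -> Prop) (G : sgraph) :
  bipartite n m G -> graph_free F G -> #|edge_set G| <= ex_bip n m F.
Proof.
move=> bG fG; have ltG : #|edge_set G| < (n * m).+1.
  by rewrite ltnS bipartite_card_edge_set.
by apply: (leq_bigmax_cond (Ordinal ltG)); apply/asboolP; exists G.
Qed.

Lemma ex_bip_attained n m (F : sgraph -> Prop) (G0 : sgraph) :
  bipartite n m G0 -> graph_free F G0 -> exists G : sgraph,
    [/\ bipartite n m G, graph_free F G & #|edge_set G| = ex_bip n m F].
Proof.
move=> bG fG; have ltG : #|edge_set G0| < (n * m).+1.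
  by rewrite ltnS bipartite_card_edge_set.
rewrite /ex_bip (bigop.bigmax_eq_arg (Ordinal ltG)); last by apply/asboolP; exists G0.
case: arg_maxnP => [|k /asboolP[G kG] _]; first by apply/asboolP; exists G0.
by exists G.
Qed.

(* The cycle of length k, for k >= 3. *)
Section Cycle.
Variable k : nat.

Definition cycle_edge : rel 'I_k :=
  fun i j => (i != j) && ((j == ordS i) || (i == ordS j)).

Lemma cycle_edge_sym : symmetric cycle_edge.
Proof. by move=> i j; rewrite /cycle_edge eq_sym orbC. Qed.

Lemma cycle_edge_irrefl : irreflexive cycle_edge.
Proof. by move=> i; rewrite /cycle_edge eqxx. Qed.

Definition cycle_graph := SGraph cycle_edge_sym cycle_edge_irrefl.
End Cycle.

(* For k >= 2: the end vertices are [inl false] and [inl true], and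
   [inr (i, p)] is the vertex at distance p.+1 from [inl false] on the i-th
   path. Two vertices are adjacent when they lie on a common path, at
   consecutive positions. *)
Section Theta.
Variables k t : nat.

Definition theta_vertex : finType := (bool + 'I_t * 'I_k.-1)%type.

Definition theta_pos (u : theta_vertex) : nat :=
  match u with
  | inl b => if b then k else 0
  | inr (_, p) => p.+1
  end.

Definition theta_same_path (u v : theta_vertex) : bool :=
  match u, v with
  | inr (i, _), inr (j, _) => i == j
  | _, _ => true
  end.

Definition theta_edge : rel theta_vertex := fun u v =>
  theta_same_path u v &&
  ((theta_pos v == (theta_pos u).+1) || (theta_pos u == (theta_pos v).+1)).

Lemma theta_edge_sym : symmetric theta_edge.
Proof.
move=> u v; rewrite /theta_edge orbC; congr (_ && _).
by case: u v => [?|[? ?]] [?|[? ?]] //=; rewrite eq_sym.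
Qed.

Lemma theta_edge_irrefl : irreflexive theta_edge.
Proof. by move=> u; rewrite /theta_edge orbb (ltn_eqF (ltnSn _)) andbF. Qed.

Definition theta_graph := SGraph theta_edge_sym theta_edge_irrefl.
End Theta.

(* Main.v *)
Require Import Defs.
From HB Require Import structures.
From mathcomp Require Import all_boot all_order all_algebra.
From mathcomp Require Import all_classical all_reals all_analysis.
From mathcomp Require Import falgebra finfield.
From mathcomp Require Import zify ring lra.

Set Implicit Arguments.
Unset Strict Implicit.
Unset Printing Implicit Defensive.

Import Order.TTheory GRing.Theory Num.Theory.
Import numFieldNormedType.Exports.
Local Open Scope ring_scope.

(* Upper bound: in a graph without C_4 the paths of length 3 between two vertices
   are internally disjoint, so without theta_{3,t} there are at most t - 1 of them.
   Counted by their middle edge, they number about the sum of d(a) d(b) over the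
   edges ab, which is at least e^3 / (n m) by Hoelder's inequality.

   Lower bound: for a prime p take the points of F_p^(j+1) and the lines with
   directions (1, y, f(y)), y in F_p^(j-1). There are p^(j+1) points, p^(2j-1)
   lines and p^(2j) incidences. A theta_{3,t} would give t + 1 directions in a
   common plane, hence a line meeting the graph of f in t + 1 points. This is
   impossible when f is the sum of the norm forms of the extensions of F_p of
   degrees 2, ..., t: restricted to any line, f is a polynomial of degree between
   2 and t. These forms use 2 + ... + t = binom(t+1, 2) - 1 variables, and setting
   some of them to 0 gives every smaller number.

   For the constant 1, consecutive primes must have ratio tending to 1. This is
   Erdos' consequence of Selberg's symmetry formula: if there are no primes just
   above x, then for most prime powers m, in logarithmic weight, the primes near
   x / m are twice as dense as expected, and iterating m -> x / m propagates this
   double density to a long interval, against Mertens' theorem. *)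

(** * Möbius and von Mangoldt functions *)

Lemma big_nat_multiples (V : nmodType) (f : nat -> V) (d N : nat) : (0 < d)%N ->
  \sum_(1 <= n < (N %/ d).+1) f (d * n)%N =
  \sum_(1 <= m < N.+1 | (d %| m)%N) f m.
Proof.
move=> d0; elim: N => [|N IH]; first by rewrite div0n !big_geq.
rewrite divnS // [RHS]big_mkcond big_nat_recr //= -big_mkcond /= -{}IH.
case: ifP => /= [dN|_]; last by rewrite add0n addr0.
rewrite add1n.
rewrite [LHS]big_nat_recr //=; congr (_ + f _).
by have /dvdnP[k kE] := dN; move: (divnS N d0); rewrite dN kE mulnK //; lia.
Qed.

Lemma sum_dvd_swap (V : nmodType) (f : nat -> nat -> V) (N : nat) :
  \sum_(1 <= d < N.+1) \sum_(1 <= n < (N %/ d).+1) f d (d * n)%N =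
  \sum_(1 <= m < N.+1) \sum_(1 <= d < N.+1 | (d %| m)%N) f d m.
Proof.
rewrite [RHS](exchange_big_dep_nat predT) //=.
by apply: eq_big_nat => d /andP[d0 _]; rewrite big_nat_multiples.
Qed.

Lemma sum_dvd_le (V : nmodType) (f : nat -> V) (m N : nat) : (0 < m <= N)%N ->
  \sum_(1 <= d < N.+1 | (d %| m)%N) f d = \sum_(1 <= d < m.+1 | (d %| m)%N) f d.
Proof.
move=> /andP[m0 mN]; rewrite (@big_cat_nat _ _ _ m.+1) //=.
rewrite [X in _ + X]big_nat_cond [X in _ + X]big_pred0 ?addr0 // => d.
by apply/negbTE/negP => /andP[/andP[md _] /dvdn_leq]; lia.
Qed.

Section ArithmeticFunctions.
Variable R : realType.
Implicit Types (m n d p N : nat).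

(** A number is a prime power when [primes] has exactly one entry; 0 and 1 have none and get the
    value 0. *)
Definition mangoldt n : R := if primes n is [:: p] then ln p%:R else 0.

(** The test on [logn] expresses that [n] is squarefree. At 0 the value is 1, which is harmless
    because the sums start at 1. *)
Definition moebius n : R :=
  if all (fun p => logn p n == 1)%N (primes n) then (-1) ^+ size (primes n) else 0.

Lemma mangoldt_ge0 n : 0 <= mangoldt n.
Proof.
rewrite /mangoldt; case E: (primes n) => [|p [|//]] //.
have : p \in primes n by rewrite E inE.
by rewrite mem_primes => /andP[/prime_gt0 p0 _]; rewrite ln_ge0 // ler1n.
Qed.

Lemma mangoldtX p k : prime p -> mangoldt (p ^ k.+1) = ln p%:R.
Proof. by move=> pp; rewrite /mangoldt primesX // primes_prime. Qed.

Lemma mangoldt_neq0 n : mangoldt n != 0 ->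
  exists p k, prime p /\ n = (p ^ k.+1)%N.
Proof.
rewrite /mangoldt; case E: (primes n) => [|p [|? ?]]; rewrite ?eqxx // => _.
have pn : p \in primes n by rewrite E inE.
move: (pn); rewrite mem_primes => /and3P[pp n0 pdn].
exists p, (logn p n).-1; split => //.
rewrite prednK ?logn_gt0 //.
by rewrite {1}(prod_prime_decomp n0) prime_decompE big_map E big_seq1.
Qed.

Lemma ln_prime_decomp m : (0 < m)%N ->
  ln m%:R = \sum_(p <- primes m) (logn p m)%:R * ln (p%:R : R).
Proof.
move=> m0; rewrite {1}(prod_prime_decomp m0) prime_decompE big_map /= natr_prod.
have : all (fun p => 0 < p)%N (primes m).
  by apply/allP => p; rewrite mem_primes => /andP[/prime_gt0].
elim: (primes m) => [|p s IH] /=; first by rewrite !big_nil ln1.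
move=> /andP[p0 ps]; rewrite !big_cons lnM ?posrE.
- by rewrite IH // natrX lnXn ?ltr0n // mulr_natl.
- by rewrite ltr0n expn_gt0 p0.
- rewrite big_seq_cond; apply: prodr_gt0 => q /andP[qs _].
  by rewrite ltr0n expn_gt0 (allP ps).
Qed.

(** At most one of the prime powers dividing [m] equals [d]. In this form the sum over [d] can be
    exchanged with the sum over prime powers. *)
Lemma mangoldt_sum_primes m d : (0 < m)%N -> (d %| m)%N ->
  mangoldt d = \sum_(p <- primes m) \sum_(1 <= k < (logn p m).+1)
     (if (d == p ^ k)%N then ln p%:R else 0).
Proof.
move=> m0 dm; have d0 := dvdn_gt0 m0 dm.
have inj p q k l : prime p -> prime q -> (p ^ k.+1 = q ^ l.+1)%N -> p = q /\ k = l.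
  move=> pp pq E; have := congr1 primes E; rewrite !primesX // !primes_prime //.
  by case=> pqE; split => //; subst q; move/eqP: E; rewrite eqn_exp2l ?prime_gt1 // => /eqP[].
have [L0|/mangoldt_neq0[p [k [pp dE]]]] := eqVneq (mangoldt d) 0.
  rewrite L0; apply/esym; rewrite big_seq; apply: big1 => p.
  rewrite mem_primes => /andP[pp _];
  rewrite big_nat_cond; apply: big1 => [[|k]] // /andP[/andP[]] // _ _ _.
  by case: eqP => // dE; rewrite -(mangoldtX k pp) -dE L0.
have pm : p \in primes m.
  by rewrite mem_primes pp m0 (dvdn_trans _ dm) // dE expnS dvdn_mulr.
rewrite (bigD1_seq p) ?primes_uniq //= [X in _ + X]big1_seq ?addr0; last first.
  move=> q /andP[qp]; rewrite mem_primes => /andP[pq _].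
  rewrite big_nat_cond; apply: big1 => [[|l]] // /andP[/andP[]] // _ _ _.
  by case: eqP => // E; move: qp; rewrite dE in E; case: (inj _ _ _ _ pp pq E) => ->; rewrite eqxx.
rewrite (bigD1_seq k.+1) ?iota_uniq //=; last first.
  by rewrite mem_index_iota /= ltnS -pfactor_dvdn // -dE.
rewrite dE eqxx mangoldtX // [X in _ + X]big1_seq ?addr0 // => l /andP[lk].
by rewrite eqn_exp2l ?prime_gt1 // eq_sym (negbTE lk).
Qed.

Lemma sum_mangoldt_dvd m : (0 < m)%N ->
  \sum_(1 <= d < m.+1 | (d %| m)%N) mangoldt d = ln m%:R.
Proof.
move=> m0; rewrite ln_prime_decomp //.
under eq_bigr => d dm do rewrite (mangoldt_sum_primes m0 dm).
rewrite exchange_big /=; apply: eq_big_seq => p.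
rewrite mem_primes => /and3P[pp _ pm].
rewrite exchange_big_nat /=.
transitivity (\sum_(1 <= k < (logn p m).+1) ln p%:R : R); last first.
  by rewrite sumr_const_nat subSS subn0 mulr_natl.
apply: eq_big_nat => k /andP[k0]; rewrite ltnS => kl.
have pkm : (p ^ k %| m)%N by rewrite pfactor_dvdn.
rewrite -big_mkcondr big_nat1_cond_eq pkm andbT ifT //.
by rewrite expn_gt0 prime_gt0 //= ltnS dvdn_leq.
Qed.

Lemma moebius1 : moebius 1 = 1.
Proof. by rewrite /moebius /= expr0. Qed.

Lemma moebius_norm_le1 n : `|moebius n| <= 1.
Proof.
by rewrite /moebius; case: ifP => _; rewrite ?normrX ?normrN1 ?expr1n // normr0.
Qed.

Lemma moebius_prime_mul p n : prime p -> (0 < n)%N ->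
  moebius (p * n) = if (p %| n)%N then 0 else - moebius n.
Proof.
move=> pp n0; have p0 := prime_gt0 pp; rewrite /moebius.
have pin : p \in primes (p * n) by rewrite primesM // primes_prime // !inE eqxx.
case: (boolP (p %| n)%N) => pn.
  rewrite ifF //; apply/negP => /allP/(_ _ pin).
  by rewrite lognM // logn_prime // eqxx eqSS -leqn0 leqNgt logn_gt0 mem_primes pp n0 pn.
have pnn : p \notin primes n by rewrite mem_primes pp n0 (negbTE pn).
have pe : perm_eq (primes (p * n)) (p :: primes n).
  apply: uniq_perm; rewrite ?primes_uniq //= ?pnn ?primes_uniq // => q.
  by rewrite primesM // primes_prime // !inE.
rewrite (perm_all _ pe) (perm_size pe) /= exprS mulN1r.
rewrite lognM // logn_prime // eqxx.
have -> : logn p n = 0%N by apply/eqP; rewrite -leqn0 leqNgt logn_gt0.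
have -> : all (fun q => logn q (p * n) == 1)%N (primes n) =
          all (fun q => logn q n == 1)%N (primes n).
  apply: eq_in_all => q qn; rewrite lognM // logn_prime //.
  by have /negbTE -> : q != p by apply: contraNneq pnn => <-.
rewrite addn0 eqxx andTb; by case: ifP => _; rewrite ?oppr0.
Qed.

(** For a prime [p] dividing [m], the divisors [p * d] with [d] prime to [p] cancel the divisors
    [d], and multiples of [p ^ 2] contribute 0. *)
Lemma sum_moebius_dvd m : (0 < m)%N ->
  \sum_(1 <= d < m.+1 | (d %| m)%N) moebius d = (m == 1)%:R.
Proof.
move=> m0; have [->|m1] := eqVneq m 1%N.
  by rewrite big_mkcond big_nat1 dvd1n moebius1.
have [p pp /dvdnP[k mE]] : exists2 p, prime p & (p %| m)%N.
  by exists (pdiv m); [apply: pdiv_prime; lia | apply: pdiv_dvd].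
have p0 := prime_gt0 pp; have k0 : (0 < k)%N by move: m0; rewrite mE muln_gt0 => /andP[].
rewrite (bigID (fun d => p %| d)%N) /=.
under eq_bigl => d do rewrite andbC.
rewrite big_mkcondr -(big_nat_multiples (fun d => if (d %| m)%N then moebius d else 0)) //.
have -> : (m %/ p = k)%N by rewrite mE mulnK.
apply/eqP; rewrite addr_eq0; apply/eqP.
transitivity (- \sum_(1 <= d < k.+1 | (d %| k)%N && ~~ (p %| d)%N) moebius d).
  rewrite -sumrN [RHS]big_mkcond; apply: eq_big_nat => d /andP[d0 _].
  rewrite mE mulnC dvdn_pmul2r // mulnC moebius_prime_mul //.
  by case: (d %| k)%N; case: (p %| d)%N.
congr (- _); rewrite !big_mkcondr -(@sum_dvd_le _ _ k m); last first.
  by rewrite k0 mE leq_pmulr.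
rewrite -!big_mkcondr; apply: eq_big => // d.
case pd : (p %| d)%N; rewrite ?andbF // !andbT mE.
by rewrite Gauss_dvdl // coprime_sym prime_coprime // pd.
Qed.

(** Expand [ln (m / d)] as the sum of [mangoldt e] over the divisors of [m / d] and exchange the
    sums: by [sum_moebius_dvd] only [e = m] survives. *)
Lemma sum_moebius_ln_dvd m : (0 < m)%N ->
  \sum_(1 <= d < m.+1 | (d %| m)%N) moebius d * ln (m%:R / d%:R) = mangoldt m.
Proof.
move=> m0.
transitivity (\sum_(1 <= d < m.+1) \sum_(1 <= e < m.+1 | (d * e %| m)%N)
   moebius d * mangoldt e).
  rewrite big_mkcond; apply: eq_big_nat => d /andP[d0 _].
  case: ifP => [/dvdnP[k mE]|dm]; last first.
    by rewrite big_pred0 // => e; apply/negP => /(dvdn_trans (dvdn_mulr _ (dvdnn d))); rewrite dm.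
  have k0 : (0 < k)%N by move: m0; rewrite mE muln_gt0 => /andP[].
  rewrite -mulr_sumr; congr (_ * _).
  have -> : (m%:R / d%:R : R) = k%:R by rewrite mE natrM mulfK // pnatr_eq0 -lt0n.
  rewrite -sum_mangoldt_dvd // -(@sum_dvd_le _ _ k m); last by rewrite k0 mE leq_pmulr.
  by apply: eq_bigl => e; rewrite mE mulnC dvdn_pmul2r.
rewrite (exchange_big_dep_nat predT) //=.
transitivity (\sum_(1 <= e < m.+1 | e == m) mangoldt e); last first.
  by rewrite big_nat1_eq m0 ltnSn.
rewrite [RHS]big_mkcond; apply: eq_big_nat => e /andP[e0 em].
rewrite -mulr_suml; case em' : (e %| m)%N; last first.
  rewrite big_pred0 ?mul0r; last first.
    by move=> d; apply/negP => /(dvdn_trans (dvdn_mull _ (dvdnn e))); rewrite em'.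
  by case: eqP => // E; move: em'; rewrite E dvdnn.
have /dvdnP[k mE] := em'.
have k0 : (0 < k)%N by move: m0; rewrite mE muln_gt0 => /andP[].
rewrite (eq_bigl (fun d => d %| k)%N); last by move=> d; rewrite mE dvdn_pmul2r.
rewrite (@sum_dvd_le _ _ k m) ?sum_moebius_dvd ?k0 //; last by rewrite mE leq_pmulr.
have -> : (e == m) = (k == 1%N) by rewrite mE -{1}[e]mul1n eqn_pmul2r // eq_sym.
by case: ifP => _; rewrite ?mul1r ?mul0r.
Qed.

(* The Tatuzawa-Iseki identity for the function [f] with [F n = f (N / n)]. *)
Lemma tatuzawa_iseki (F : nat -> R) N : (0 < N)%N ->
  \sum_(1 <= d < N.+1) moebius d * ln (N%:R / d%:R) *
     \sum_(1 <= n < (N %/ d).+1) F (d * n)%N =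
  F 1%N * ln N%:R + \sum_(1 <= m < N.+1) mangoldt m * F m.
Proof.
move=> N0; under eq_bigr => d _ do rewrite mulr_sumr.
rewrite (sum_dvd_swap (fun d m => moebius d * ln (N%:R / d%:R) * F m)).
transitivity (\sum_(1 <= m < N.+1) ((if m == 1%N then F m * ln N%:R else 0) + mangoldt m * F m)); last first.
  by rewrite big_split /= -big_mkcond big_nat1_eq /= ltnS N0.
(* Split [ln (N / d)] as [ln (N / m) + ln (m / d)]: the first part survives only for [m = 1], the
   second gives [mangoldt m]. *)
apply: eq_big_nat => m /andP[m0 mN].
rewrite sum_dvd_le ?m0 // -mulr_suml -sum_moebius_ln_dvd //.
have -> : (if m == 1%N then F m * ln N%:R else 0) = (m == 1)%:R * ln (N%:R / m%:R) * F m.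
  by case: eqP => [->|_]; rewrite ?mul0r // mul1r divr1 mulrC.
rewrite -mulrDl; congr (_ * _); rewrite -sum_moebius_dvd // mulr_suml -big_split /=.
rewrite [LHS]big_nat_cond [RHS]big_nat_cond; apply: eq_bigr => d /andP[/andP[d0 dm] dvd].
have [d0' m0'] : (0 < d%:R :> R) /\ (0 < m%:R :> R) by rewrite !ltr0n.
have N0' : 0 < N%:R :> R by rewrite ltr0n.
by rewrite -mulrDr !ln_div ?posrE //; congr (_ * _); ring.
Qed.

End ArithmeticFunctions.

(** * Chebyshev's and Mertens' estimates *)

Section LogEstimates.
Variable R : realType.
Implicit Types (m n d p N : nat).

Lemma ln_succ_bounds n : (0 < n)%N ->
  (n.+1%:R)^-1 <= ln n.+1%:R - ln (n%:R : R) <= (n%:R)^-1.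
Proof.
move=> n0; have [n0' n1'] : (0 < n%:R :> R) /\ (0 < n.+1%:R :> R) by rewrite !ltr0n.
have nS : n.+1%:R = n%:R + 1 :> R by rewrite natr1.
apply/andP; split.
  rewrite -opprB lerNr -ln_div ?posrE //.
  have -> : n%:R / n.+1%:R = 1 + (- n.+1%:R^-1) :> R by field; rewrite ?pnatr_eq0.
  by apply: le_ln1Dx; rewrite ltrN2 invf_lt1 // ltr1n.
rewrite -ln_div ?posrE //.
have -> : n.+1%:R / n%:R = 1 + n%:R^-1 :> R by rewrite nS; field; rewrite pnatr_eq0 -lt0n.
by apply: le_ln1Dx; rewrite (lt_trans (ltrN10 _)) // invr_gt0.
Qed.

Lemma ln_le_subr1 (x : R) : 0 < x -> ln x <= x - 1.
Proof. by move=> x0; rewrite -{1}[x](subrKC 1); apply: le_ln1Dx; lra. Qed.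

Definition harmonic_sum N : R := \sum_(1 <= n < N.+1) (n%:R)^-1.

Lemma harmonic_sumS N : harmonic_sum N.+1 = harmonic_sum N + (N.+1%:R)^-1.
Proof. by rewrite /harmonic_sum big_nat_recr. Qed.

(** The sequence [k] increases, [h] decreases, and they differ by at most [1 / N]; [g] is their
    common limit, taken as the supremum of [k]. *)
Lemma harmonic_sum_euler : exists g : R, 0 <= g <= 1 /\ forall N, (0 < N)%N ->
  ln N%:R + g <= harmonic_sum N <= ln N%:R + g + N%:R^-1.
Proof.
pose k N := harmonic_sum N - ln N.+1%:R.
pose h N := harmonic_sum N - ln N%:R.
have k_nd m n : (m <= n)%N -> k m <= k n.
  elim: n => [|n IH]; first by rewrite leqn0 => /eqP ->.
  rewrite leq_eqVlt => /orP[/eqP -> //|/IH /le_trans]; apply.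
  rewrite /k harmonic_sumS; have /andP[_] := ln_succ_bounds (ltn0Sn n).
  move: (ln n.+2%:R) (ln n.+1%:R) (n.+1%:R^-1) => a b c; lra.
have h_ni m n : (0 < m)%N -> (m <= n)%N -> h n <= h m.
  move=> m0; elim: n => [|n IH]; first by rewrite leqn0 => /eqP ->.
  rewrite leq_eqVlt => /orP[/eqP -> //|mn]; apply: le_trans (IH mn).
  have n0 : (0 < n)%N by apply: leq_trans m0 mn.
  rewrite /h harmonic_sumS; have /andP[+ _] := ln_succ_bounds n0.
  move: (ln n.+1%:R) (ln n%:R) (n.+1%:R^-1) => a b c; lra.
have kh n : (0 < n)%N -> k n <= h n <= k n + n%:R^-1.
  move=> n0; rewrite /k /h; have /andP[] := ln_succ_bounds n0.
  have : 0 < n.+1%:R^-1 :> R by rewrite invr_gt0 ltr0n.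
  move: (ln n.+1%:R) (ln n%:R) (n.+1%:R^-1) (n%:R^-1) => a b c d ? ? ?.
  by apply/andP; split; lra.
have kh' m n : (0 < n)%N -> k m <= h n.
  move=> n0; apply: le_trans (k_nd m (maxn m n) (leq_maxl _ _)) _.
  have mn0 : (0 < maxn m n)%N by rewrite leq_max n0 orbT.
  by apply: le_trans (h_ni n (maxn m n) n0 (leq_maxr _ _)); case/andP: (kh _ mn0).
have supk : has_sup (range k).
  by split; [exists (k 0%N); exists 0%N | exists (h 1%N) => _ [m _ <-]; apply: kh'].
have lb m : k m <= sup (range k) by apply: sup_upper_bound => //; exists m.
have ub n : (0 < n)%N -> sup (range k) <= h n.
  by move=> n0; apply: ge_sup => [|_ [m _ <-]]; [exists (k 0%N); exists 0%N | apply: kh'].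
exists (sup (range k)); split.
  apply/andP; split.
    by apply: le_trans (lb 0%N); rewrite /k /harmonic_sum big_geq // ln1 subrr.
  apply: le_trans (ub 1%N _) _ => //.
  by rewrite /h /harmonic_sum big_nat1 ln1 subr0 invr1.
move=> n n0; have := ub n n0; have /andP[_ kh1] := kh n n0; have := lb n.
by rewrite /h in kh1 *; move=> ? ?; apply/andP; split; lra.
Qed.

Lemma harmonic_sum_le N : (0 < N)%N -> harmonic_sum N <= 1 + ln N%:R.
Proof.
elim: N => [//|[|N] IH _]; first by rewrite /harmonic_sum big_nat1 ln1 invr1 addr0.
rewrite harmonic_sumS; have /andP[+ _] := ln_succ_bounds (ltn0Sn N).
have := IH isT.
move: (ln N.+2%:R) (ln N.+1%:R) (N.+2%:R^-1) => a b c; lra.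
Qed.

Lemma ln_fact_bounds N : (0 < N)%N ->
  N%:R * ln N%:R - N%:R <= ln (N`!%:R : R) <= N%:R * ln N%:R - N%:R + ln N%:R + 1.
Proof.
(* With the harmonic sum as error term the induction closes, since a step adds at most
   [1 / (N + 1)]. *)
move=> N0; suff : N%:R * ln N%:R - N%:R + 1 <= ln (N`!%:R : R)
    <= N%:R * ln N%:R - N%:R + harmonic_sum N.
  by move=> /andP[? ?]; have := harmonic_sum_le N0; move=> ?; apply/andP; split; lra.
elim: N N0 => [//|[|N] IH _].
  by rewrite factS fact0 muln1 ln1 mulr0 /harmonic_sum big_nat1 invr1; lra.
have /andP[IH1 IH2] := IH isT.
rewrite factS natrM lnM ?posrE ?ltr0n ?fact_gt0 // harmonic_sumS.
have /andP[L1 L2] := ln_succ_bounds (ltn0Sn N).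
set n := N.+1%:R : R in IH1 IH2 L1 L2 *.
have n0 : 0 < n by rewrite ltr0n.
have nS : N.+2%:R = n + 1 :> R by rewrite /n natr1.
rewrite nS in L1 L2 *.
have L1' : n * (n + 1)^-1 <= n * (ln (n + 1) - ln n) by rewrite ler_pM2l.
have L2' : n * (ln (n + 1) - ln n) <= 1 by rewrite mulrC -ler_pdivlMr // div1r.
have E : n * (n + 1)^-1 = 1 - (n + 1)^-1 by field; lra.
by apply/andP; split; lra.
Qed.

End LogEstimates.

Section Chebyshev.
Variable R : realType.
Implicit Types (m n d p N : nat).
Local Notation mangoldt := (@mangoldt R).

Definition psi N : R := \sum_(1 <= n < N.+1) mangoldt n.

Lemma psiS N : psi N.+1 = psi N + mangoldt N.+1.
Proof. by rewrite /psi big_nat_recr. Qed.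

Lemma psi0 : psi 0 = 0.
Proof. by rewrite /psi big_geq. Qed.

Lemma psi_nd m n : (m <= n)%N -> psi m <= psi n.
Proof.
elim: n => [|n IH]; first by rewrite leqn0 => /eqP ->.
rewrite leq_eqVlt => /orP[/eqP -> //|/IH /le_trans]; apply.
by rewrite psiS lerDl mangoldt_ge0.
Qed.

Lemma psi_ge0 n : 0 <= psi n.
Proof. by rewrite -psi0 psi_nd. Qed.

Lemma ln_fact N : ln (N`!)%:R = \sum_(1 <= m < N.+1) ln (m%:R : R).
Proof.
elim: N => [|N IH]; first by rewrite fact0 ln1 big_geq.
by rewrite big_nat_recr //= -IH factS natrM lnM ?posrE ?ltr0n ?fact_gt0 // addrC.
Qed.

Lemma ln_fact_mangoldt N :
  ln (N`!)%:R = \sum_(1 <= m < N.+1) mangoldt m * (N %/ m)%:R.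
Proof.
rewrite ln_fact; transitivity (\sum_(1 <= m < N.+1) \sum_(1 <= d < N.+1 | (d %| m)%N) mangoldt d).
  by apply: eq_big_nat => m /andP[m0 mN]; rewrite sum_dvd_le ?m0 // sum_mangoldt_dvd.
rewrite -(sum_dvd_swap (fun d _ => mangoldt d)); apply: eq_bigr => d _.
by rewrite sumr_const_nat subSS subn0 mulr_natr.
Qed.

(** Both sides run over the pairs with [d * n <= N]. *)
Lemma sum_hyperbola (g : nat -> nat -> R) N :
  \sum_(1 <= d < N.+1) \sum_(1 <= n < (N %/ d).+1) g d n =
  \sum_(1 <= n < N.+1) \sum_(1 <= d < (N %/ n).+1) g d n.
Proof.
have E h : \sum_(1 <= d < N.+1) \sum_(1 <= n < (N %/ d).+1) h d n =
    \sum_(1 <= d < N.+1) \sum_(1 <= n < N.+1 | (d * n <= N)%N) h d n :> R.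
  apply: eq_big_nat => d /andP[d0 dN].
  rewrite (@big_cat_nat _ _ _ (N %/ d).+1 1 N.+1) //=; last by rewrite ltnS leq_div.
  rewrite [X in _ = _ + X]big_nat_cond [X in _ = _ + X]big_pred0 ?addr0; last first.
    move=> n; apply/negbTE/negP => /andP[/andP[+ _]].
    by rewrite ltn_divLR // mulnC ltnNge => /negbTE ->.
  rewrite [RHS]big_nat_cond [LHS]big_nat_cond; apply: eq_bigl => n.
  rewrite andbT; case nb : (1 <= n < _)%N => //=.
  by move: nb => /andP[_]; rewrite ltnS leq_divRL // mulnC => ->.
rewrite !(E, E (fun d n => g n d)) (exchange_big_dep_nat predT) //=.
by apply: eq_bigr => i _; apply: eq_bigl => k; rewrite mulnC.
Qed.

Lemma ln_fact_psi N : ln (N`!)%:R = \sum_(1 <= n < N.+1) psi (N %/ n).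
Proof.
rewrite ln_fact_mangoldt /psi (sum_hyperbola (fun _ n => mangoldt n)).
by apply: eq_bigr => d _; rewrite sumr_const_nat subSS subn0 mulr_natr.
Qed.

Lemma psi_double M : psi (M.*2) - psi M <= M%:R * (2 * ln 2).
Proof.
have [->|M0] := posnP M; first by rewrite psi0 subr0 mul0r.
have le1 : ln ('C(M.*2, M))%:R <= M%:R * (2 * ln (2 : R)).
  have -> : M%:R * (2 * ln (2 : R)) = ln (2 ^ M.*2)%:R.
    by rewrite natrX lnXn ?ltr0n // -[_ *+ M.*2]mulr_natl -muln2 natrM; ring.
  rewrite ler_ln ?posrE ?ltr0n ?expn_gt0 // ?bin_gt0 -?addnn ?leq_addr // ler_nat.
  have -> : (2 = 1 + 1)%N by [].
  rewrite expnDn (bigD1 (inord M)) //= inordK ?ltnS ?leq_addr //.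
  by rewrite !exp1n !muln1 leq_addr.
apply: le_trans le1.
(* In [ln 'C(2M, M)] the coefficient of [mangoldt m] is
   [2M %/ m - 2 (M %/ m)], which is nonnegative, and positive if [M < m <= 2M]. *)
have E : ln ('C(M.*2, M))%:R = ln ((M.*2)`!)%:R - 2 * ln (M`!)%:R :> R.
  have := bin_fact (_ : M <= M.*2)%N; rewrite -addnn addnK leq_addr => /(_ isT) <-.
  rewrite !natrM !lnM ?posrE ?mulr_gt0 ?ltr0n ?fact_gt0 // ?bin_gt0 ?leq_addr //; ring.
rewrite {}E !ln_fact_mangoldt.
have -> : \sum_(1 <= m < M.+1) mangoldt m * (M %/ m)%:R =
    \sum_(1 <= m < M.*2.+1) mangoldt m * (M %/ m)%:R.
  rewrite [RHS](@big_cat_nat _ _ _ M.+1) //=; last by rewrite ltnS -addnn leq_addr.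
  rewrite [X in _ + X]big_nat_cond [X in _ + X]big1 ?addr0 // => m /andP[/andP[mM _] _].
  by rewrite divn_small // mulr0.
have -> : psi M.*2 - psi M = \sum_(1 <= m < M.*2.+1) mangoldt m * (M < m)%:R.
  rewrite /psi (@big_cat_nat _ _ _ M.+1 1 M.*2.+1) //=; last by rewrite ltnS -addnn leq_addr.
  rewrite [RHS](@big_cat_nat _ _ _ M.+1) //=; last by rewrite ltnS -addnn leq_addr.
  rewrite addrAC subrr add0r [X in _ = X + _]big_nat_cond [X in _ = X + _]big1 ?add0r.
    by apply: eq_big_nat => m /andP[-> _]; rewrite mulr1.
  by move=> m /andP[/andP[_ mM] _]; rewrite ltnNge -ltnS mM mulr0.
rewrite mulr_sumr -sumrB big_nat_cond [X in _ <= X]big_nat_cond; apply: ler_sum => m /andP[/andP[m0 mM] _].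
rewrite mulrCA -mulrBr ler_wpM2l ?mangoldt_ge0 // lerBrDr -natrM -natrD ler_nat.
case: (ltnP M m) => /= Mm.
  by rewrite (divn_small Mm) muln0 addn0 divn_gt0.
rewrite add0n leq_divRL //; have := leq_divM M m; nia.
Qed.

Lemma ln2_le1 : ln (2 : R) <= 1.
Proof. by have := @ln_le_subr1 R 2 (ltr0Sn R 1); lra. Qed.

(** Summing [psi_double] over powers of 2, with [ln 2 <= 1], gives the constant 2; rounding [N] up
    to a power of 2 doubles it. *)
Lemma psi_le N : psi N <= 4 * N%:R.
Proof.
have P2 k : psi (2 ^ k) <= 2 * (2 ^ k)%:R.
  elim: k => [|k IH].
    by rewrite expn0 /psi big_nat1 /mangoldt /= mulr1 ler0n.
  have := psi_double (2 ^ k); rewrite expnS mul2n -mul2n natrM mul2n.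
  have : 0 <= (2 ^ k)%:R * (2 - 2 * ln 2) :> R.
    by rewrite mulr_ge0 //; have := ln2_le1; lra.
  by set u := (2 ^ k)%:R; lra.
have [->|N0] := posnP N; first by rewrite psi0 mulr0.
have [k /andP[k1 k2]] : exists k, (2 ^ k <= N < 2 ^ k.+1)%N.
  exists (trunc_log 2 N); rewrite trunc_logP //= trunc_log_ltn //.
apply: le_trans (psi_nd (ltnW k2)) _; apply: le_trans (P2 _) _.
have : (2 ^ k)%:R <= N%:R :> R by rewrite ler_nat.
by rewrite expnS natrM; lra.
Qed.

Definition mertens_sum N : R := \sum_(1 <= m < N.+1) mangoldt m / m%:R.

(** In [ln N! = sum mangoldt m * (N %/ m)], replacing [N %/ m] by [N / m] changes the sum by at most
    [psi N <= 4 N]; then compare with Stirling's bounds. *)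
Lemma mertens_sum_bounds N : (0 < N)%N ->
  ln N%:R - 1 <= mertens_sum N <= ln N%:R + 4.
Proof.
move=> N0; have N0' : 0 < N%:R :> R by rewrite ltr0n.
have /andP[L1 L2] := @ln_fact_bounds R N N0.
have E1 : ln (N`!)%:R <= N%:R * mertens_sum N.
  rewrite ln_fact_mangoldt mulr_sumr big_nat_cond [X in _ <= X]big_nat_cond.
  apply: ler_sum => m /andP[/andP[m0 _] _].
  rewrite mulrCA ler_wpM2l ?mangoldt_ge0 // ler_pdivlMr ?ltr0n // -natrM ler_nat.
  exact: leq_divM.
have E2 : N%:R * mertens_sum N - psi N <= ln (N`!)%:R.
  rewrite ln_fact_mangoldt mulr_sumr -sumrB big_nat_cond [X in _ <= X]big_nat_cond.
  apply: ler_sum => m /andP[/andP[m0 _] _].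
  rewrite mulrCA -[X in _ - X]mulr1 -mulrBr ler_wpM2l ?mangoldt_ge0 //.
  rewrite lerBlDr ler_pdivrMr ?ltr0n // natr1 -natrM ler_nat.
  by rewrite ltnW // ltn_ceil.
have lnN : ln N%:R <= N%:R - 1 :> R by apply: ln_le_subr1.
have P := psi_le N.
by apply/andP; split; rewrite -(ler_pM2l N0'); lra.
Qed.

End Chebyshev.

(** * Selberg's symmetry formula *)

Section Selberg.
Variable R : realType.
Implicit Types (m n d p N : nat).
Local Notation mangoldt := (@mangoldt R).
Local Notation psi := (@psi R).

Lemma sum_inv_sqrt_le N :
  \sum_(1 <= d < N.+1) (Num.sqrt (d%:R : R))^-1 <= 2 * Num.sqrt N%:R.
Proof.
elim: N => [|N IH]; first by rewrite big_geq // mulr_ge0 // sqrtr_ge0.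
rewrite big_nat_recr //=; apply: le_trans (lerD IH (lexx _)) _.
have b0 : 0 < Num.sqrt (N.+1%:R : R) by rewrite sqrtr_gt0 ltr0n.
have a0 : 0 <= Num.sqrt (N%:R : R) by rewrite sqrtr_ge0.
have : Num.sqrt (N.+1%:R : R) ^+ 2 = Num.sqrt (N%:R : R) ^+ 2 + 1.
  by rewrite !sqr_sqrtr ?ler0n // natr1.
move: b0 a0; move: (Num.sqrt _) (Num.sqrt _) => b a b0 a0 E.
rewrite -lerBrDl -(ler_pM2r b0) mulVf ?gt_eqF //.
have : 0 <= (a - b) ^+ 2 by apply: sqr_ge0.
by nra.
Qed.

(** With [u] the fourth root of [y], [ln y = 4 ln u <= 4 (u - 1)]. This bounds the terms of the
    Tatuzawa-Iseki identity by multiples of [sqrt (N / d)], whose sum is [O(N)]. *)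
Lemma ln_sqr_le_sqrt (y : R) : 1 <= y -> ln y * (ln y + 3) <= 28 * Num.sqrt y.
Proof.
move=> y1; have y0 : 0 <= y by lra.
set u := Num.sqrt (Num.sqrt y).
have u0 : 0 <= u by apply: sqrtr_ge0.
have u2 : Num.sqrt y = u ^+ 2 by rewrite /u sqr_sqrtr // sqrtr_ge0.
have u4 : y = u ^+ 4 by rewrite -[4%N]/(2 * 2)%N exprM -u2 sqr_sqrtr.
have u1 : 1 <= u.
  by rewrite /u -sqrtr1 ler_wsqrtr // -sqrtr1 ler_wsqrtr.
have lu0 : 0 <= ln u by apply: ln_ge0.
have lu : ln u <= u - 1 by apply: ln_le_subr1; lra.
have -> : ln y = 4 * ln u by rewrite u4 lnXn ?mulr_natl //; lra.
by rewrite u2; nra.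
Qed.

Lemma selberg_symmetry N : (0 < N)%N ->
  2 * N%:R * ln N%:R - 70 * N%:R <=
  psi N * ln N%:R + \sum_(1 <= m < N.+1) mangoldt m * psi (N %/ m) <=
  2 * N%:R * ln N%:R + 70 * N%:R.
Proof.
move=> N0; have N0' : 0 < N%:R :> R by rewrite ltr0n.
have N1' : 1 <= N%:R :> R by rewrite ler1n.
have [g [/andP[g0 g1] Hg]] := harmonic_sum_euler R.
(* With the constant [1 + g], where [g] is Euler's constant, the inner sums of
   the Tatuzawa-Iseki identity are [O(log)], so its left side is [O(N)]. *)
pose F m : R := psi (N %/ m) - N%:R / m%:R + (1 + g).
have TI := tatuzawa_iseki F N0.
have inner d : (0 < d <= N)%N ->
    `|\sum_(1 <= n < (N %/ d).+1) F (d * n)%N| <= ln (N%:R / d%:R) + 3.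
  move=> /andP[d0 dN]; set M := (N %/ d)%N; set y := N%:R / d%:R : R.
  have d0' : 0 < d%:R :> R by rewrite ltr0n.
  have M0 : (0 < M)%N by rewrite divn_gt0.
  have My : M%:R <= y by rewrite ler_pdivlMr // -natrM ler_nat leq_divM.
  have yM : y <= M%:R + 1 by rewrite ler_pdivrMr // natr1 -natrM ler_nat ltnW // ltn_ceil.
  have -> : \sum_(1 <= n < M.+1) F (d * n)%N =
      ln (M`!)%:R - y * harmonic_sum R M + (1 + g) * M%:R.
    rewrite ln_fact_psi /harmonic_sum mulr_sumr -sumrB.
    have -> : (1 + g) * M%:R = \sum_(1 <= n < M.+1) (1 + g).
      by rewrite sumr_const_nat subSS subn0 mulr_natr.
    rewrite -big_split /=; apply: eq_big_nat => n /andP[n0 _].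
    by rewrite /F divnMA natrM invfM mulrA.
  have M0' : 0 < M%:R :> R by rewrite ltr0n.
  have M1' : 1 <= M%:R :> R by rewrite ler1n.
  have /andP[L1 L2] := @ln_fact_bounds R M M0.
  have /andP[H1 H2] := Hg M M0.
  have lM : ln M%:R <= ln y by rewrite ler_ln ?posrE //; apply: lt_le_trans My.
  have lM0 : 0 <= ln M%:R :> R by apply: ln_ge0.
  set H := harmonic_sum R M in H1 H2 *.
  have H0 : 0 <= H by lra.
  have yH1 : M%:R * (ln M%:R + g) <= y * H by apply: ler_pM => //; lra.
  have yH2 : y * H <= (M%:R + 1) * (ln M%:R + g + M%:R^-1) by apply: ler_pM => //; lra.
  have MV : M%:R * M%:R^-1 = 1 :> R by rewrite mulfV // gt_eqF.
  have MV1 : M%:R^-1 <= 1 :> R by rewrite invf_le1.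
  have yH3 : y * H <= M%:R * ln M%:R + M%:R * g + ln M%:R + 3.
    apply: le_trans yH2 _; rewrite mulrDl mul1r !mulrDr MV.
    by move: (M%:R^-1) MV1 => v; lra.
  by rewrite ler_norml; apply/andP; split; lra.
have bound : `|F 1%N * ln N%:R + \sum_(1 <= m < N.+1) mangoldt m * F m| <= 56 * N%:R.
  rewrite -TI; apply: le_trans (ler_norm_sum _ _ _) _.
  apply: (@le_trans _ _ (28 * Num.sqrt N%:R * \sum_(1 <= d < N.+1) (Num.sqrt (d%:R : R))^-1)).
    rewrite mulr_sumr big_nat_cond [X in _ <= X]big_nat_cond.
    apply: ler_sum => d /andP[/andP[d0 dN] _].
    have d0' : 0 < d%:R :> R by rewrite ltr0n.
    have y1 : 1 <= N%:R / d%:R :> R by rewrite ler_pdivlMr // mul1r ler_nat.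
    have -> : 28 * Num.sqrt N%:R / Num.sqrt d%:R = 28 * Num.sqrt (N%:R / d%:R : R).
      by rewrite sqrtrM // sqrtrV // mulrA.
    apply: le_trans (ln_sqr_le_sqrt y1).
    rewrite !normrM; apply: ler_pM; rewrite ?mulr_ge0 ?normr_ge0 //.
      rewrite (ger0_norm (ln_ge0 y1)) -[X in _ <= X]mul1r.
      by rewrite ler_wpM2r ?ln_ge0 // moebius_norm_le1.
    by apply: inner; rewrite d0.
  have := sum_inv_sqrt_le N; have := sqr_sqrtr (ler0n R N); have := sqrtr_ge0 (N%:R : R).
  by move: (Num.sqrt _) (\sum_(_ <= _ < _) _) => s S s0 s2 Ss; rewrite -s2; nra.
(* One main term [N ln N] comes from [F 1], the other from the Mertens sum; the constant [1 + g] in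
   [F] costs [O(N)] by Chebyshev's bound. *)
have E : \sum_(1 <= m < N.+1) mangoldt m * F m =
    \sum_(1 <= m < N.+1) mangoldt m * psi (N %/ m) - N%:R * mertens_sum R N + (1 + g) * psi N.
  rewrite /mertens_sum /psi !mulr_sumr -sumrB -big_split /=; apply: eq_bigr => m _.
  by rewrite /F /psi; ring.
rewrite {}E /F divn1 divr1 in bound.
have P := psi_le R N; have P0 := psi_ge0 R N.
have /andP[A1 A2] := mertens_sum_bounds R N0.
have lN : ln N%:R <= N%:R - 1 :> R by apply: ln_le_subr1.
have lN0 : 0 <= ln N%:R :> R by apply: ln_ge0.
move: bound; set S := \sum_(1 <= m < N.+1) _; rewrite ler_norml => /andP[B1 B2].
have A1' : N%:R * (ln N%:R - 1) <= N%:R * mertens_sum R N by rewrite ler_pM2l.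
have A2' : N%:R * mertens_sum R N <= N%:R * (ln N%:R + 4) by rewrite ler_pM2l.
have gP : 0 <= g * psi N <= psi N.
  by rewrite mulr_ge0 //= ler_piMl.
have gL : 0 <= g * ln N%:R <= ln N%:R.
  by rewrite mulr_ge0 //= ler_piMl.
by move/andP: gP => [? ?]; move/andP: gL => [? ?]; apply/andP; split; lra.
Qed.

End Selberg.

(** * Real arguments, logarithmic weights and prime gaps *)

Section RealArguments.
Variable R : realType.
Implicit Types (m n d p N : nat) (x y : R).
Local Notation mangoldt := (@mangoldt R).
Local Notation psi := (@psi R).
Local Notation truncn := (@Num.truncn R).

Definition rpsi y : R := psi (truncn y).

Lemma rpsi_nd x y : x <= y -> rpsi x <= rpsi y.
Proof. by move=> xy; apply/psi_nd/le_truncn. Qed.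

Lemma rpsi_ge0 y : 0 <= rpsi y.
Proof. exact: psi_ge0. Qed.

Lemma rpsi_le y : 0 <= y -> rpsi y <= 4 * y.
Proof.
by move=> y0; apply: le_trans (psi_le _ _) _; rewrite ler_pM2l // truncn_le.
Qed.

Lemma rpsi_small y : y < 1 -> rpsi y = 0.
Proof.
move=> y1; rewrite /rpsi; have -> : truncn y = 0%N by apply/truncn0Pn; rewrite -ltNge.
exact: psi0.
Qed.

Lemma truncn_divn y m : 0 <= y -> (0 < m)%N -> truncn (y / m%:R) = (truncn y %/ m)%N.
Proof.
move=> y0 m0; have m0' : 0 < m%:R :> R by rewrite ltr0n.
apply: truncn_def; have /andP[t1 t2] := truncn_itv y0; apply/andP; split.
  rewrite ler_pdivlMr // -natrM; apply: le_trans t1; rewrite ler_nat; exact: leq_divM.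
rewrite ltr_pdivrMr // -natrM; apply: lt_le_trans t2 _; rewrite ler_nat.
exact: ltn_ceil.
Qed.

(** Terms with [m > y] vanish, so any [N] from [truncn y] on gives the same value; sums at two
    arguments can thus share one range. *)
Definition selberg_sum N y : R := \sum_(1 <= m < N.+1) mangoldt m * rpsi (y / m%:R).

Lemma ln_ratio_le x y : 0 < x -> x <= y -> x * (ln y - ln x) <= y - x.
Proof.
move=> x0 xy; have y0 : 0 < y by apply: lt_le_trans xy.
rewrite -ln_div ?posrE // -ler_pdivlMl //.
have -> : x^-1 * (y - x) = y / x - 1 by field; rewrite gt_eqF.
by apply: ln_le_subr1; rewrite divr_gt0.
Qed.

Lemma rpsi_selberg N y : 1 <= y -> (truncn y <= N)%N ->
  2 * y * ln y - 80 * y <= rpsi y * ln y + selberg_sum N y <= 2 * y * ln y + 80 * y.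
Proof.
move=> y1 yN; have y0 : 0 <= y by lra.
have -> : selberg_sum N y =
    \sum_(1 <= m < (truncn y).+1) mangoldt m * psi (truncn y %/ m).
  rewrite /selberg_sum (@big_cat_nat _ _ _ (truncn y).+1) //=.
  rewrite [X in _ + X]big_nat_cond [X in _ + X]big1 ?addr0.
    by apply: eq_big_nat => m /andP[m0 _]; rewrite /rpsi truncn_divn.
  move=> m /andP[/andP[ym _] _]; rewrite rpsi_small ?mulr0 //.
  rewrite ltr_pdivrMr ?mul1r ?ltr0n; last by apply: leq_trans ym.
  by rewrite -truncn_lt_nat.
have t0 : (0 < truncn y)%N by rewrite truncn_gt0.
have /andP[S1 S2] := selberg_symmetry R t0.
have /andP[t1 t2] := truncn_itv y0.
rewrite -natr1 in t2.
have P := psi_le R (truncn y); have P0 := psi_ge0 R (truncn y).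
rewrite /rpsi; move: S1 S2; set S := \sum_(_ <= _ < _) _.
set T := (truncn y)%:R in t1 t2 P *.
have T1 : 1 <= T by rewrite ler1n.
have T0 : 0 < T by lra.
have lT := @ln_ratio_le T y T0 t1.
have lTy : ln T <= ln y by rewrite ler_ln ?posrE //; lra.
have lT0 : 0 <= ln T by apply: ln_ge0.
have ly : ln y <= y - 1 by apply: ln_le_subr1; lra.
move: (psi _) P P0 => p P P0 S1 S2.
have e1 : p * (ln y - ln T) <= 4 * (y - T).
  apply: (@le_trans _ _ (4 * T * (ln y - ln T))); last by rewrite -mulrA ler_pM2l.
  by apply: ler_wpM2r => //; lra.
have e2 : 0 <= p * (ln y - ln T) by apply: mulr_ge0 => //; lra.
have e3 : 0 <= (y - T) * ln y by apply: mulr_ge0; lra.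
have e4 : (y - T) * ln y <= ln y by rewrite ler_piMl; lra.
have e5 : 0 <= T * (ln y - ln T) by apply: mulr_ge0; lra.
by apply/andP; split; lra.
Qed.

(** By Mertens' estimate all integers up to [y] weigh [ln y + O(1)], so this weight measures lengths
    on the logarithmic scale. *)
Definition log_weight (P : pred nat) y : R :=
  \sum_(1 <= m < (truncn y).+1 | P m) mangoldt m / m%:R.

Lemma log_weight_split (P : pred nat) x y : x <= y ->
  log_weight P y - log_weight P x =
  \sum_((truncn x).+1 <= m < (truncn y).+1 | P m) mangoldt m / m%:R.
Proof.
move=> xy; rewrite /log_weight (@big_cat_nat _ _ _ (truncn x).+1 1 (truncn y).+1) //=.
  by rewrite addrAC subrr add0r.
by rewrite ltnS le_truncn.
Qed.

Lemma weight_ge0 m : 0 <= mangoldt m / m%:R.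
Proof. by rewrite mulr_ge0 ?mangoldt_ge0 // invr_ge0 ler0n. Qed.

Lemma log_weight_nd (P : pred nat) x y : x <= y -> log_weight P x <= log_weight P y.
Proof.
move=> xy; rewrite -subr_ge0 log_weight_split //.
by apply: sumr_ge0 => m _; apply: weight_ge0.
Qed.

Lemma log_weight_ge0 (P : pred nat) y : 0 <= log_weight P y.
Proof. by apply: sumr_ge0 => m _; apply: weight_ge0. Qed.

Lemma log_weight_bounds y : 1 <= y ->
  ln y - 2 <= log_weight predT y <= ln y + 4.
Proof.
move=> y1; have y0 : 0 <= y by lra.
have t0 : (0 < truncn y)%N by rewrite truncn_gt0.
have /andP[t1 t2] := truncn_itv y0; rewrite -natr1 in t2.
have /andP[M1 M2] := mertens_sum_bounds R t0.
have T1 : 1 <= (truncn y)%:R :> R by rewrite ler1n.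
have E : log_weight predT y = mertens_sum R (truncn y) by [].
have lTy : ln (truncn y)%:R <= ln y by rewrite ler_ln ?posrE //; lra.
have T0 : 0 < (truncn y)%:R :> R by lra.
have lT := ln_ratio_le T0 t1.
have : ln y - ln (truncn y)%:R <= 1.
  rewrite -(ler_pM2l T0); lra.
by move=> ?; apply/andP; split; rewrite E; lra.
Qed.

Lemma log_weight_rpsi x y : 0 <= x -> x <= y -> 0 < y ->
  (rpsi y - rpsi x) / y <= log_weight predT y - log_weight predT x.
Proof.
move=> x0 xy y0; rewrite log_weight_split // /rpsi /psi.
rewrite (@big_cat_nat _ _ _ (truncn x).+1 1 (truncn y).+1) //=; last by rewrite ltnS le_truncn.
rewrite addrAC subrr add0r mulr_suml [X in X <= _]big_nat_cond [X in _ <= X]big_nat_cond.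
apply: ler_sum => m /andP[/andP[m1 m2] _].
apply: ler_wpM2l; first exact: mangoldt_ge0.
have m0 : (0 < m)%N by apply: leq_trans m1.
rewrite lef_pV2 ?posrE ?ltr0n //.
by rewrite -truncn_ge_nat // ltW.
Qed.

(* A prime power [n] that is not prime is [m ^ 2] or [m ^ 2 * p], where [m] is a power of
   the same prime [p]. *)
Lemma sum_mangoldt_nonprime N r : (N < r.+1 ^ 2)%N ->
  \sum_(1 <= n < N.+1 | ~~ prime n) mangoldt n <= 2 * psi r.
Proof.
move=> Nr.
pose h n m : R := if (n == m ^ 2)%N || (n == m ^ 2 * pdiv m)%N then mangoldt m else 0.
have h0 n m : 0 <= h n m by rewrite /h; case: ifP => _ //; apply: mangoldt_ge0.
apply: (@le_trans _ _ (\sum_(1 <= n < N.+1) \sum_(1 <= m < r.+1) h n m)).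
  rewrite big_mkcond big_nat_cond [X in _ <= X]big_nat_cond.
  apply: ler_sum => n /andP[/andP[n0 nN] _]; rewrite ltnS in nN.
  case: ifP => [npr|_]; last by apply: sumr_ge0.
  have [->|/mangoldt_neq0[p [k [pp nE]]]] := eqVneq (mangoldt n) 0; first by apply: sumr_ge0.
  have p0 := prime_gt0 pp.
  case: k nE => [|k] nE; first by move: npr; rewrite nE expn1 pp.
  pose m := (p ^ (k./2).+1)%N.
  have pm : pdiv m = p by rewrite /m pdiv_pfactor.
  have nm : (n == m ^ 2)%N || (n == m ^ 2 * pdiv m)%N.
    rewrite pm nE /m -expnM -expnSr !eqn_exp2l ?prime_gt1 //.
    apply/orP; have := odd_double_half k; case: (odd k) => /= kE; [right|left]; apply/eqP; lia.
  have m0 : (0 < m)%N by rewrite expn_gt0 p0.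
  have mr : (m < r.+1)%N.
    have mn : (m ^ 2 <= n)%N.
      by case/orP: nm => /eqP -> //; rewrite leq_pmulr // pm.
    by rewrite -(ltn_sqr) (leq_ltn_trans mn) // (leq_ltn_trans nN).
  rewrite (bigD1_seq m) ?iota_uniq //= ?mem_index_iota ?m0 //.
  rewrite {1}/h nm nE mangoldtX // /m mangoldtX // lerDl; apply: sumr_ge0 => *; exact: h0.
rewrite exchange_big /= /psi mulr_sumr; apply: ler_sum => m _.
apply: (@le_trans _ _ (\sum_(1 <= n < N.+1 | n == (m ^ 2)%N) mangoldt m +
   \sum_(1 <= n < N.+1 | n == (m ^ 2 * pdiv m)%N) mangoldt m)).
  rewrite [X in _ <= X + _]big_mkcond [X in _ <= _ + X]big_mkcond -big_split /=.
  apply: ler_sum => n _; rewrite /h; have := mangoldt_ge0 R m.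
  by case: eqP; case: eqP => //= *; lra.
have L := mangoldt_ge0 R m.
by rewrite !big_nat1_eq; case: ifP => _; case: ifP => _; lra.
Qed.

(** Only proper prime powers contribute. [sum_mangoldt_nonprime] with [r] the integer part of
    [sqrt y], and [psi r <= 4 r], give the constant 8. *)
Lemma rpsi_gap x y : 0 <= x -> x <= y ->
  (forall p, prime p -> x < p%:R <= y -> False) ->
  rpsi y - rpsi x <= 8 * Num.sqrt y.
Proof.
move=> x0 xy np; have y0 : 0 <= y by lra.
pose r := truncn (Num.sqrt y).
have /andP[r1 r2] := truncn_itv (sqrtr_ge0 y).
have Nr : (truncn y < r.+1 ^ 2)%N.
  rewrite truncn_lt_nat // -(sqr_sqrtr y0) natrX ltrXn2r // ?nnegrE ?sqrtr_ge0 //.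
have H := sum_mangoldt_nonprime Nr.
have P := psi_le R r; rewrite -/r in r1.
apply: (@le_trans _ _ (2 * psi r)); last by lra.
apply: le_trans H.
rewrite /rpsi /psi (@big_cat_nat _ _ _ (truncn x).+1 1 (truncn y).+1) //=; last by rewrite ltnS le_truncn.
rewrite [X in _ <= X](@big_cat_nat _ _ _ (truncn x).+1) //=; last by rewrite ltnS le_truncn.
rewrite addrAC subrr add0r.
rewrite -[X in X <= _]add0r; apply: lerD; first by apply: sumr_ge0 => *; exact: mangoldt_ge0.
rewrite [X in _ <= X]big_mkcond big_nat_cond [X in _ <= X]big_nat_cond.
apply: ler_sum => m /andP[/andP[xm my] _]; case: ifPn => // /negbNE pm.
exfalso; apply: (np m pm); rewrite -truncn_lt_nat // xm /=.
by rewrite -truncn_ge_nat.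
Qed.

End RealArguments.

(** * Primes in short intervals *)

Section PrimesInShortIntervals.
Variables (R : realType) (s : R).
Hypotheses (s_gt0 : 0 < s) (s_le : s <= 1 / 10).
Implicit Types (m n d p N : nat) (x y u : R).
Local Notation mangoldt := (@mangoldt R).
Local Notation truncn := (@Num.truncn R).
Local Notation rpsi := (@rpsi R).
Local Notation lam := (1 + s).

Lemma ln_lam : 0 <= ln lam <= s.
Proof. by rewrite ln_ge0 ?lerDl ?(ltW s_gt0) //= le_ln1Dx //; have := s_gt0; lra. Qed.

Lemma selberg_sum_diff N y :
  selberg_sum N (lam * y) - selberg_sum N y =
  \sum_(1 <= m < N.+1) mangoldt m * (rpsi (lam * y / m%:R) - rpsi (y / m%:R)).
Proof. by rewrite /selberg_sum -sumrB; apply: eq_bigr => m _; rewrite mulrBr. Qed.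

Lemma rpsi_short_ge0 y m : 0 <= y -> 0 <= rpsi (lam * y / m%:R) - rpsi (y / m%:R).
Proof.
move=> y0; rewrite subr_ge0; apply: rpsi_nd; rewrite ler_wpM2r ?invr_ge0 //.
by have := s_gt0; nra.
Qed.

(** Selberg's formula at [lam * y] minus the one at [y]. Replacing [ln (lam * y)] by [ln y] costs
    [O(y)], since [ln lam <= s] and [rpsi] grows at most linearly. *)
Lemma rpsi_short_bounds y N : 1 <= y -> (truncn (lam * y) <= N)%N ->
  `|\sum_(1 <= m < N.+1) mangoldt m * (rpsi (lam * y / m%:R) - rpsi (y / m%:R))
    + (rpsi (lam * y) - rpsi y) * ln y - 2 * s * y * ln y| <= 170 * y.
Proof.
move=> y1 yN; have s0 := s_gt0; have s1 := s_le; rewrite -selberg_sum_diff.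
have yly : y <= lam * y by nra.
have /andP[A1 A2] := rpsi_selberg (le_trans y1 yly) yN.
have /andP[B1 B2] := rpsi_selberg y1 (leq_trans (le_truncn yly) yN).
move: A1 A2 B1 B2; rewrite lnM ?posrE; [|lra|lra].
have P0 := rpsi_ge0 (lam * y).
have P1 : rpsi (lam * y) <= 4 * (lam * y) by apply: rpsi_le; nra.
have /andP[l0 l1] := ln_lam.
move: (selberg_sum _ _) (selberg_sum _ _) (rpsi _) (rpsi _) P0 P1 => S0 S1 p0 p1 P0 P1.
have e1 : 0 <= p1 * ln lam by apply: mulr_ge0.
have e2 : p1 * ln lam <= 4 * (lam * y) * s by apply: ler_pM.
have e3 : 0 <= lam * y * ln lam by apply: mulr_ge0 => //; nra.
have e4 : lam * y * ln lam <= lam * y * s by apply: ler_wpM2l => //; nra.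
have e5 : lam * y * s <= y / 2 by nra.
have e6 : lam * y <= 2 * y by nra.
have e7 : lam * y = y + s * y by ring.
move=> A1 A2 B1 B2; rewrite ler_norml; apply/andP; split; nra.
Qed.

Lemma rpsi_short_upper y : 1 <= y ->
  (rpsi (lam * y) - rpsi y) * ln y <= 2 * s * y * ln y + 170 * y.
Proof.
move=> y1; have := rpsi_short_bounds y1 (leqnn _); rewrite ler_norml => /andP[_].
set S := \sum_(_ <= _ < _) _.
have : 0 <= S.
  by apply: sumr_ge0 => m _; rewrite mulr_ge0 ?mangoldt_ge0 // rpsi_short_ge0 //; lra.
by lra.
Qed.

(* Selberg's formula bounds the number of primes in [(y / m, lam y / m]],
   weighted by logarithms, by about [2 s y / m]; [deficient] says that this
   bound is missed by a positive proportion. *)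
Definition deficient y m : bool :=
  rpsi (lam * y / m%:R) - rpsi (y / m%:R) < (2 * s - s / 5) * (y / m%:R).

(** For [m <= y / Y] the argument [y / m] is large enough for Selberg's upper bound with error [e],
    and a deficient [m] saves [s / 5]. For larger [m] Chebyshev's bound is covered by the term with
    5. *)
Lemma rpsi_short_deficiency (e Y y : R) m : 0 < e -> e <= s -> 1 <= Y ->
  170 / e <= ln Y -> 0 < y -> (0 < m)%N ->
  rpsi (lam * y / m%:R) - rpsi (y / m%:R) <= y / m%:R *
    (2 * s + e - s / 5 * (deficient y m)%:R + 5 * (truncn (y / Y)%R < m)%N%:R).
Proof.
move=> e0 es Y1 lY y0 m0; have s0 := s_gt0; have s1 := s_le.
have m0' : 0 < m%:R :> R by rewrite ltr0n.
have ym0 : 0 < y / m%:R by apply: divr_gt0.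
have yY0 : 0 <= y / Y by rewrite divr_ge0 ?(ltW y0) // (le_trans ler01).
case: (ltnP (truncn (y / Y)) m) => Ym /=.
  have P1 : rpsi (lam * y / m%:R) <= 4 * (lam * (y / m%:R)).
    rewrite -mulrA; apply: rpsi_le; apply: mulr_ge0 (ltW ym0).
    by rewrite addr_ge0 // ltW.
  have := rpsi_ge0 (y / m%:R); move: (rpsi _) (rpsi _) P1 => p1 p0.
  move: (y / m%:R) ym0 => z z0 P1 P0; have sz : s * z <= z / 10.
    by rewrite mulrC ler_pM2l // -div1r.
  have ez : 0 <= e * z by rewrite mulr_ge0 // ltW.
  have sz0 : 0 <= s * z by rewrite mulr_ge0 // ltW.
  by clear -z0 P1 P0 sz ez sz0; case: (deficient y m) => /=; lra.
have YM : Y <= y / m%:R.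
  rewrite ler_pdivlMr // mulrC -ler_pdivlMr -?truncn_ge_nat //.
  exact: lt_le_trans Y1.
have U : rpsi (lam * y / m%:R) - rpsi (y / m%:R) <= (2 * s + e) * (y / m%:R).
  have := rpsi_short_upper (le_trans Y1 YM).
  have lYm : 170 / e <= ln (y / m%:R).
    by apply: le_trans lY _; rewrite ler_ln ?posrE // (lt_le_trans _ Y1).
  have lp : 0 < ln (y / m%:R) by apply: lt_le_trans lYm; rewrite divr_gt0.
  have eL : 170 <= e * ln (y / m%:R) by rewrite mulrC -ler_pdivrMr.
  rewrite !mulrA => H; rewrite -(ler_pM2r lp); apply: le_trans H _.
  have : 170 * (y / m%:R) <= e * ln (y / m%:R) * (y / m%:R) by rewrite ler_pM2r.
  by clear -m0'; lra.
case D : (deficient y m) => /=; last by clear -U; lra.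
by move: D; rewrite /deficient => D; clear -D ym0 e0; nra.
Qed.

(** The gap makes [rpsi (lam * y) - rpsi y] negligible in Selberg's formula, so the sum over [m]
    must supply nearly the whole main term. *)
Lemma rpsi_short_sum_ge (e x y : R) N : 1 <= x -> x <= y -> e <= s ->
  (truncn (lam * y) <= N)%N -> rpsi (lam * y) - rpsi y <= e * x -> 0 <= e ->
  (2 * s - e) * ln x - 170 <=
    \sum_(1 <= m < N.+1) mangoldt m * (rpsi (lam * y / m%:R) - rpsi (y / m%:R)) / y.
Proof.
move=> x1 xy es yN gap e0; have s0 := s_gt0.
have y1 := le_trans x1 xy; have x0 := lt_le_trans ltr01 x1; have y0 := lt_le_trans ltr01 y1.
have := rpsi_short_bounds y1 yN; rewrite ler_norml => /andP[+ _].
rewrite -mulr_suml ler_pdivlMr //; set S := \sum_(_ <= _ < _) _ => HS.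
have ly0 : 0 <= ln y by apply: ln_ge0.
have g1 : (rpsi (lam * y) - rpsi y) * ln y <= e * x * ln y by apply: ler_wpM2r.
have g2 : e * x * ln y <= e * y * ln y by rewrite !ler_wpM2r // ler_wpM2l.
have g3 : (2 * s - e) * (y * ln x) <= (2 * s - e) * (y * ln y).
  apply: ler_wpM2l; first by clear -es s0; lra.
  by rewrite ler_pM2l // ler_ln.
by clear -HS g1 g2 g3; lra.
Qed.

Lemma rpsi_short_sum_le (e Y x y : R) : 0 < e -> e <= s -> 1 <= Y ->
  170 / e <= ln Y -> 0 < y -> y <= 3 * x ->
  \sum_(1 <= m < (truncn (3 * x)).+1)
     mangoldt m * (rpsi (lam * y / m%:R) - rpsi (y / m%:R)) / y
   <= (2 * s + e) * log_weight predT (3 * x) - s / 5 * log_weight (deficient y) (3 * x)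
     + 5 * (log_weight predT (3 * x) - log_weight predT (y / Y)).
Proof.
move=> e0 es Y1 lY y0 yx; set N := truncn (3 * x).
have Y0 : 0 < Y by apply: lt_le_trans Y1.
have -> : log_weight predT (3 * x) - log_weight predT (y / Y) =
    \sum_(1 <= m < N.+1) mangoldt m / m%:R * (truncn (y / Y)%R < m)%N%:R.
  have yY : y / Y <= 3 * x.
    by apply: le_trans yx; rewrite ler_pdivrMr // ler_peMr // ltW.
  have tN : (truncn (y / Y) <= N)%N by apply: le_truncn.
  rewrite log_weight_split // [RHS](@big_cat_nat _ _ _ (truncn (y / Y)).+1) //=.
  rewrite [X in _ = X + _]big_nat_cond [X in _ = X + _]big1 ?add0r.
    by apply: eq_big_nat => m /andP[-> _]; rewrite mulr1.
  by move=> m /andP[/andP[_ mM] _]; rewrite ltnNge -ltnS mM mulr0.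
rewrite {1}/log_weight.
have -> : log_weight (deficient y) (3 * x) =
    \sum_(1 <= m < N.+1) mangoldt m / m%:R * (deficient y m)%:R.
  rewrite /log_weight big_mkcond; apply: eq_bigr => m _.
  by case: ifP; rewrite ?mulr1 ?mulr0.
rewrite !mulr_sumr -sumrB -big_split /= big_nat_cond [X in _ <= X]big_nat_cond.
apply: ler_sum => m /andP[/andP[m0 mN] _].
have m0' : 0 < m%:R :> R by rewrite ltr0n.
have L0 := mangoldt_ge0 R m.
rewrite mulrAC; have := rpsi_short_deficiency e0 es Y1 lY y0 m0.
move/(ler_wpM2l (divr_ge0 L0 (ltW y0)))/le_trans; apply.
by rewrite le_eqVlt; apply/orP; left; apply/eqP; field; rewrite !gt_eqF.
Qed.

(** The lower bound forced by the gap nearly equals the upper bound without the deficiency term, so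
    that term is at most a multiple of [e * ln x]. *)
Lemma deficient_weight (e : R) : 0 < e -> e <= s -> exists x0 : R, forall x y,
  x0 <= x -> x <= y -> lam * y <= 3 * x -> rpsi (lam * y) - rpsi y <= e * x ->
  s / 5 * log_weight (deficient y) (3 * x) <= 4 * e * ln x.
Proof.
move=> e0 es; have s0 := s_gt0; have s1 := s_le.
pose Y := expR (170 / e).
(* This threshold gives [220 + 850 / e <= e * ln x]: [850 / e] is [5 * ln Y], and 220 covers the
   bounded errors. *)
exists (expR ((220 + 850 / e) / e)) => x y xx0 xy yx gap.
have e1 : e <= 1 by clear -es s1; lra.
have ie : 1 <= e^-1 by rewrite invf_ge1.
have Y1 : 1 <= Y.
  by rewrite /Y -expR0 ler_expR; rewrite mulr_ge0 // invr_ge0 ltW.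
have x0 : 0 < x by apply: lt_le_trans (expR_gt0 _) xx0.
have lx : (220 + 850 / e) / e <= ln x.
  by rewrite -[X in X <= _]expRK ler_ln ?posrE ?expR_gt0.
have Yx : Y <= x.
  apply: le_trans xx0; rewrite /Y ler_expR ler_pM2r ?invr_gt0 //.
  by clear -ie; move: (e^-1) ie => v; lra.
have lx' : 220 + 850 / e <= e * ln x.
  by move: lx; rewrite ler_pdivrMr // [ln x * e]mulrC.
have x1 := le_trans Y1 Yx; have y1 := le_trans x1 xy.
have y0 : 0 < y := lt_le_trans ltr01 y1.
have Y0 : 0 < Y := lt_le_trans ltr01 Y1.
have lY : ln Y = 170 / e by rewrite /Y expRK.
have ly : ln x <= ln y by rewrite ler_ln.
have yx3 : y <= 3 * x by apply: le_trans yx; rewrite ler_peMl ?(ltW y0) // lerDl ltW.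
have low := rpsi_short_sum_ge x1 xy es (le_truncn yx) gap (ltW e0).
have lY' : 170 / e <= ln Y by rewrite lY.
have up := rpsi_short_sum_le e0 es Y1 lY' y0 yx3.
have yY1 : 1 <= y / Y by rewrite ler_pdivlMr // mul1r (le_trans Yx).
have x31 : 1 <= 3 * x by clear -x1; lra.
have /andP[_ W1] := log_weight_bounds x31.
have /andP[W2 _] := log_weight_bounds yY1.
have l3 : ln (3 * x) <= ln x + 2.
  rewrite lnM ?posrE // addrC lerD2l.
  by apply: le_trans (@ln_le_subr1 R 3 _) _ => //; clear -e0; lra.
have lyY : ln (y / Y) = ln y - 170 / e by rewrite ln_div ?posrE // lY.
have W3 : (2 * s + e) * log_weight predT (3 * x) <= (2 * s + e) * (ln x + 6).
  by apply: ler_wpM2l; [clear -s0 e0; lra | clear -W1 l3; lra].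
have := le_trans low up.
by move: W1 W2 W3 lx' l3 ie; rewrite lyY; clear -s1 es e0 ly; move: (e^-1) => v; lra.
Qed.

Lemma lam_pow10 : lam ^+ 10 <= 3.
Proof.
have s0 := s_gt0; have s1 := s_le.
have a2 : lam ^+ 2 <= 121 / 100 by rewrite expr2; nra.
have b2 : 0 <= lam ^+ 2 by apply: sqr_ge0.
have a4 : lam ^+ 4 <= 147 / 100.
  have -> : lam ^+ 4 = lam ^+ 2 * lam ^+ 2 by rewrite -exprD.
  apply: le_trans (ler_pM b2 b2 a2 a2) _; lra.
have b4 : 0 <= lam ^+ 4 by rewrite -[4%N]/(2 * 2)%N exprM sqr_ge0.
have a8 : lam ^+ 8 <= 217 / 100.
  have -> : lam ^+ 8 = lam ^+ 4 * lam ^+ 4 by rewrite -exprD.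
  apply: le_trans (ler_pM b4 b4 a4 a4) _; lra.
have b8 : 0 <= lam ^+ 8 by rewrite -[8%N]/(4 * 2)%N exprM sqr_ge0.
have -> : lam ^+ 10 = lam ^+ 8 * lam ^+ 2 by rewrite -exprD.
apply: le_trans (ler_pM b8 b2 a8 a2) _; lra.
Qed.

(* If there are no primes between [x] and [lam ^ 10 x], then Selberg's formula at
   [lam ^ k x], [k < 10], shows that few prime powers are bad; and for any other
   [m] the whole interval from [x / m] to [lam ^ 10 x / m] has twice the expected
   density of primes. *)
Definition bad x m : bool := [exists k : 'I_10, deficient (lam ^+ k * x) m].

Lemma bad_weight (e : R) : 0 < e -> e <= s -> exists x0 : R, forall x,
  x0 <= x -> (forall p, prime p -> x < p%:R <= lam ^+ 10 * x -> False) ->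
  log_weight (bad x) (3 * x) <= 200 * e / s * ln x.
Proof.
move=> e0 es; have [x0 Hx0] := deficient_weight e0 es.
have s0 := s_gt0; have l1 : 1 <= lam by lra.
(* The prime-free interval has [rpsi] increment at most [8 * sqrt (3 * x)], which is at most [e * x]
   once [x >= 192 / e ^ 2], where [192 = 3 * 8 ^ 2]. *)
exists (Num.max x0 (Num.max 1 (192 / e ^+ 2))) => x; rewrite !ge_max => /and3P[xx0 x1 xe] np.
have l10 := lam_pow10.
have x00 : 0 < x by lra.
have gap : rpsi (lam ^+ 10 * x) - rpsi x <= e * x.
  apply: le_trans (rpsi_gap _ _ np) _; first by lra.
    by rewrite ler_peMl ?exprn_ege1 // ltW.
  have l0 : 0 <= lam ^+ 10 by apply: exprn_ge0; lra.
  have S0 : 0 <= Num.sqrt (lam ^+ 10 * x) by apply: sqrtr_ge0.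
  have S2 : Num.sqrt (lam ^+ 10 * x) ^+ 2 <= 3 * x.
    by rewrite sqr_sqrtr; [rewrite ler_pM2r | apply: mulr_ge0; lra].
  have e2 : 192 <= x * e ^+ 2 by rewrite -ler_pdivrMr // exprn_gt0.
  rewrite -(@ler_pXn2r _ 2) ?nnegrE //; last by apply: mulr_ge0; lra.
  by rewrite !exprMn; nra.
have H k : (k < 10)%N -> log_weight (deficient (lam ^+ k * x)) (3 * x) <= 20 * e / s * ln x.
  move=> k10.
  have xk : x <= lam ^+ k * x by rewrite ler_peMl ?exprn_ege1 // ltW.
  have kx : lam * (lam ^+ k * x) <= lam ^+ 10 * x.
    by rewrite mulrA -exprS ler_pM2r // ler_weXn2l.
  have : s / 5 * log_weight (deficient (lam ^+ k * x)) (3 * x) <= 4 * e * ln x.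
    apply: Hx0 => //; first by apply: le_trans kx _; rewrite ler_pM2r.
    apply: le_trans gap; apply: lerB; exact: rpsi_nd.
  move: (log_weight _ _) => w.
  have -> : 20 * e / s * ln x = (20 * e * ln x) / s by rewrite mulrAC.
  rewrite ler_pdivlMr //; lra.
apply: (@le_trans _ _ (\sum_(k < 10) log_weight (deficient (lam ^+ k * x)) (3 * x))).
  rewrite /log_weight (exchange_big_dep predT) //= [X in X <= _]big_mkcond /=.
  apply: ler_sum => m _; case: ifP => [/existsP[k dk]|_]; last first.
    by apply: sumr_ge0 => k _; apply: weight_ge0.
  rewrite (bigD1 k) //= lerDl; apply: sumr_ge0 => i _; exact: weight_ge0.
apply: le_trans (ler_sum _ (fun (k : 'I_10) _ => H k (ltn_ord k))) _.
by rewrite sumr_const card_ord -mulr_natr le_eqVlt; apply/orP; left; apply/eqP; ring.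
Qed.

(** * Propagation of double density along good integers *)

Section Chain.
Variables x : R.
Hypothesis x_gt0 : 0 < x.
Local Notation A := (@log_weight R predT).
Local Notation V := (log_weight (bad x)).

(** Pigeonhole for the weight: the bad integers do not fill the interval. *)
Lemma find_good (a b : R) : 0 <= a -> a <= b -> V b - V a < A b - A a ->
  exists m, [/\ (0 < m)%N, a < m%:R, m%:R <= b & ~~ bad x m].
Proof.
move=> a0 ab; apply: contraPP => nex; apply/negP; rewrite -leNgt.
rewrite !log_weight_split // [X in _ <= X]big_mkcond /= [X in X <= _]big_nat_cond.
rewrite [X in _ <= X]big_nat_cond; apply: ler_sum => m /andP[/andP[am mb] _].
case: ifPn => // nb; exfalso; apply: nex; exists m; split => //.
- by apply: leq_trans am.
- by rewrite -truncn_lt_nat.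
- by rewrite -truncn_ge_nat //; lra.
Qed.

(** Non-deficiency gives mass [9 / 5 * s * z] on the interval from [z] to [lam * z]. Dividing by its
    upper end costs a factor [lam <= 11 / 10], and [13 / 8 * 11 / 10 < 9 / 5]. *)
Lemma good_mass k m : (k < 10)%N -> (0 < m)%N -> ~~ bad x m ->
  13 / 8 * s <= A (lam ^+ k.+1 * x / m%:R) - A (lam ^+ k * x / m%:R).
Proof.
move=> k10 m0; rewrite negb_exists => /forallP/(_ (Ordinal k10)) /=.
rewrite /deficient -leNgt => H.
have s0 := s_gt0; have s1 := s_le.
set y := lam ^+ k * x in H *.
have -> : lam ^+ k.+1 * x / m%:R = lam * (y / m%:R) by rewrite /y exprS !mulrA.
rewrite -mulrA in H.
have ym0 : 0 < y / m%:R.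
  by apply: divr_gt0; [apply: mulr_gt0 => //; apply: exprn_gt0; lra | rewrite ltr0n].
move: (y / m%:R) ym0 H => z z0 H.
apply: le_trans (log_weight_rpsi _ _ _); [|lra|nra|nra].
have lz : 0 < lam * z by nra.
rewrite ler_pdivlMr //; apply: le_trans H.
have : s * z * (13 / 8 * lam) <= s * z * (9 / 5) by apply: ler_wpM2l; [nra | lra].
lra.
Qed.

(* From a good [m] take a good [q] just above [x / m]: the interval from [x / q],
   just below [m], to [lam ^ 10 x / q] then has double density. Take the next good
   [m] near its upper end, and repeat. After [r] steps this contradicts Mertens'
   estimate. *)
Lemma chain_contradiction u (r : nat) : lam <= u -> 6 < 3 * s * r%:R ->
  let B := expR 7 * lam ^+ (10 * r) in
  (V (u * B) - V u) + (V (lam * x / u) - V (x / (u * B))) <= s -> False.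
Proof.
move=> ul sr B Vs; have s0 := s_gt0; have s1 := s_le; have x0 := x_gt0.
have l1 : 1 <= lam by lra.
have u0 : 0 < u by lra.
have lam0 : 0 < lam := lt_le_trans ltr01 l1.
have e71 : 1 <= expR 7 :> R by rewrite -expR0 ler_expR.
have B1 : 1 <= B by rewrite /B mulr_ege1 // exprn_ege1.
have uB : u <= u * B by rewrite ler_peMr // ltW.
have uB0 : 0 < u * B by lra.
have V1 : 0 <= V (u * B) - V u by rewrite subr_ge0 log_weight_nd.
have V2 : 0 <= V (lam * x / u) - V (x / (u * B)).
  rewrite subr_ge0 log_weight_nd // ler_pdivrMr // mulrAC -mulrA.
  rewrite [u * B]mulrC mulfK ?gt_eqF // mulrAC.
  by rewrite ler_peMl ?(ltW x0) // mulr_ege1.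
(* The bad weight in each of the two ranges is at most [s], less than the mass [13 / 8 * s] of the
   interval. *)
have primal (a b : R) : u <= a -> a <= b -> b <= u * B -> 13 / 8 * s <= A b - A a ->
    exists m, [/\ (0 < m)%N, a < m%:R, m%:R <= b & ~~ bad x m].
  move=> ua ab bB HA; apply: find_good => //; first by lra.
  have := log_weight_nd (bad x) ua; have := log_weight_nd (bad x) bB; lra.
have dual m : (0 < m)%N -> u < m%:R -> m%:R <= u * B -> ~~ bad x m ->
    exists q, [/\ (0 < q)%N, x / m%:R < q%:R, q%:R <= lam * x / m%:R & ~~ bad x q].
  move=> m0 um mB mg; have m0' : 0 < m%:R :> R by rewrite ltr0n.
  have := @good_mass 0 m isT m0 mg; rewrite expr1 expr0 mul1r => HA.
  apply: find_good; first by apply: divr_ge0; lra.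
    by rewrite ler_pM2r ?invr_gt0 // ler_peMl // ltW.
  have i1 : x / (u * B) <= x / m%:R by rewrite ler_pM2l // lef_pV2 ?posrE.
  have i2 : lam * x / m%:R <= lam * x / u.
    by rewrite ler_pM2l ?lef_pV2 ?posrE //; [apply: ltW | nra].
  have := log_weight_nd (bad x) i1; have := log_weight_nd (bad x) i2; lra.
(* The excess of [A] over [ln] starts at -2 or more and grows by [3 * s] per step. Mertens' estimate
   caps it at 4, which [6 < 3 * s * r] contradicts after [r] steps. *)
have chain k : (k <= r)%N -> exists q, [/\ (0 < q)%N, ~~ bad x q,
    u <= lam * (x / q%:R), x / q%:R <= u * expR 7 * lam ^+ (10 * k) &
    -2 + 3 * s * k%:R <= A (x / q%:R) - ln (x / q%:R)].
  elim: k => [_|k IH kr].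
    (* The Mertens errors add up to 6, so logarithmic length 7 leaves mass at least 1. *)
    have [m [m0 um mu mg]] : exists m, [/\ (0 < m)%N, u < m%:R, m%:R <= u * expR 7 & ~~ bad x m].
      apply: primal => //.
      - by rewrite ler_peMr // ltW.
      - by rewrite ler_pM2l // /B ler_peMr ?exprn_ege1 // ltW // expR_gt0.
      have u1 : 1 <= u by lra.
      have ue1 : 1 <= u * expR 7 by apply: mulr_ege1.
      have /andP[w1 _] := log_weight_bounds ue1; have /andP[_ w2] := log_weight_bounds u1.
      rewrite lnM ?posrE ?expR_gt0 // expRK in w1; lra.
    have muB : m%:R <= u * B.
      by apply: le_trans mu _; rewrite ler_pM2l // /B ler_peMr ?exprn_ege1 // ltW // expR_gt0.
    have [q [q0 mq qm qg]] := dual m m0 um muB mg.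
    have m0' : 0 < m%:R :> R by rewrite ltr0n.
    have q0' : 0 < q%:R :> R by rewrite ltr0n.
    have zm : x / q%:R < m%:R by rewrite ltr_pdivrMr // mulrC -ltr_pdivrMr.
    have mz : m%:R <= lam * (x / q%:R).
      by rewrite mulrA ler_pdivlMr // mulrC -ler_pdivlMr.
    have z1 : 1 <= x / q%:R by nra.
    exists q; split => //; first by lra.
      by rewrite muln0 expr0 mulr1; lra.
    by have /andP[w _] := log_weight_bounds z1; rewrite mulr0; lra.
  have [q [q0 qg uz zu Az]] := IH (ltnW kr).
  have q0' : 0 < q%:R :> R by rewrite ltr0n.
  set z := x / q%:R in uz zu Az.
  have z0 : 0 < z by apply: divr_gt0.
  have e9 : lam ^+ 9 * x / q%:R = lam ^+ 9 * z by rewrite mulrA.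
  have e10 : lam ^+ 10 * x / q%:R = lam ^+ 10 * z by rewrite mulrA.
  have u9 : u <= lam ^+ 9 * z.
    apply: le_trans uz _; rewrite ler_pM2r // -[X in X <= _]expr1 ler_weXn2l //.
  have z10 : lam ^+ 10 * z <= u * B.
    rewrite /B mulrA; apply: le_trans (_ : lam ^+ 10 * (u * expR 7 * lam ^+ (10 * k)) <= _).
      by rewrite ler_pM2l // exprn_gt0.
    rewrite mulrCA -exprD -mulnS ler_pM2l ?mulr_gt0 ?expR_gt0 //.
    by rewrite ler_weXn2l // leq_mul2l.
  have [m [m0 zm mz mg]] : exists m, [/\ (0 < m)%N, lam ^+ 9 * z < m%:R,
      m%:R <= lam ^+ 10 * z & ~~ bad x m].
    apply: primal => //; first by rewrite ler_pM2r // ler_weXn2l.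
    by have := @good_mass 9 q isT q0 qg; rewrite e9 e10.
  have um : u < m%:R by apply: le_lt_trans zm.
  have muB : m%:R <= u * B by apply: le_trans z10.
  have [q' [q0'' mq qm qg']] := dual m m0 um muB mg.
  have m0' : 0 < m%:R :> R by rewrite ltr0n.
  have q1' : 0 < q'%:R :> R by rewrite ltr0n.
  exists q'; set z' := x / q'%:R.
  have zm' : z' < m%:R by rewrite ltr_pdivrMr // mulrC -ltr_pdivrMr.
  have mz' : m%:R <= lam * z'.
    by rewrite mulrA ler_pdivlMr // mulrC -ler_pdivlMr.
  have z8 : lam ^+ 8 * z <= z'.
    rewrite -(@ler_pM2l _ lam); last by apply: lt_le_trans l1.
    by rewrite mulrA -exprS; apply: le_trans (ltW zm) mz'.
  have zz' : z' <= lam ^+ 10 * z by apply: ltW (lt_le_trans zm' mz).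
  split => //; first exact: le_trans (ltW um) mz'.
    apply: le_trans zz' _; rewrite mulnS exprD [X in _ <= X]mulrCA ler_pM2l //.
    by rewrite exprn_gt0.
  have z'0 : 0 < z' by apply: divr_gt0.
  have Al : A (lam ^+ 8 * z) <= A z' by apply: log_weight_nd.
  (* Eight short intervals carry [8 * (13 / 8) * s = 13 * s], while [ln] grows by at most [10 * s]
     from [z] to [z']: a net gain of [3 * s]. *)
  have A8 : 13 * s <= A (lam ^+ 8 * z) - A z.
    have G i : (i < 8)%N -> 13 / 8 * s <= A (lam ^+ i.+1 * z) - A (lam ^+ i * z).
      by move=> i8; have := @good_mass i q (leq_trans i8 (isT : 8 <= 10)%N) q0 qg; rewrite -!mulrA.
    have := (G 0 isT, G 1 isT, G 2 isT, G 3 isT)%N; have := (G 4 isT, G 5 isT, G 6 isT, G 7 isT)%N.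
    by rewrite expr0 mul1r; clear -s0 => -[[[? ?] ?] ?] [[[? ?] ?] ?]; lra.
  have ll : ln z' <= ln z + 10 * s.
    apply: (@le_trans _ _ (ln (lam ^+ 10 * z))); first by rewrite ler_ln // posrE (lt_le_trans z'0).
    rewrite lnM ?posrE ?exprn_gt0 // lnXn //.
    by have /andP[_ +] := ln_lam; rewrite -mulr_natl; clear -s0; lra.
  by rewrite -natr1; clear -Az Al A8 ll; lra.
have [q [q0 qg uz _ Az]] := chain r (leqnn r).
have z1 : 1 <= x / q%:R by nra.
have /andP[_ w] := log_weight_bounds z1.
by lra.
Qed.

End Chain.

(** If there were no prime, [chain_contradiction] at [u = B ^ i] would put bad weight above [s] into
    a window around [B ^ i] and its dual window around [x / B ^ i]. About [ln x / ln B] such windows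
    exceed the total from [bad_weight]. *)
Lemma prime_in_short_interval : exists x0 : R, forall x, x0 <= x ->
  exists p, prime p /\ x < p%:R <= lam ^+ 10 * x.
Proof.
have s0 := s_gt0; have s1 := s_le.
have l1 : 1 <= lam by lra.
pose r := (truncn (2 / s)).+1.
have sr : 6 < 3 * s * r%:R.
  have := truncnS_gt (2 / s); rewrite -/r ltr_pdivrMr //; lra.
have [B BE] : exists B, B = expR 7 * lam ^+ (10 * r) by exists (expR 7 * lam ^+ (10 * r)).
have B7 : expR 7 <= B by rewrite BE ler_peMr ?exprn_ege1 // ltW // expR_gt0.
have lamB : lam <= B.
  by apply: le_trans B7; have := expR_ge1Dx (7 : R); lra.
have B0 : 0 < B by lra.
have lB7 : 7 <= ln B by rewrite -[X in X <= _](expRK 7) ler_ln ?posrE ?expR_gt0.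
have lB0 : 0 < ln B by lra.
(* With 2400 the total bad weight is at most [s / 12] times [ln x / ln B]. *)
pose e := s ^+ 2 / (2400 * ln B).
have c0 : 0 < 2400 :> R by rewrite ltr0n.
have e0 : 0 < e by apply: divr_gt0 (exprn_gt0 2 s0) (mulr_gt0 c0 lB0).
have es : e <= s.
  rewrite /e ler_pdivrMr; last exact: mulr_gt0 c0 lB0.
  rewrite expr2 ler_pM2l //; clear -lB7 s1; move: (ln B) lB7 => l lB7; lra.
have [x0 Hx0] := bad_weight e0 es.
exists (Num.max x0 (expR (4 * ln B))) => x; rewrite ge_max => /andP[xx0 xB].
apply: contrapT => nex.
have x_gt0 : 0 < x by apply: lt_le_trans (expR_gt0 _) xB.
have lx : 4 * ln B <= ln x by rewrite -[X in X <= _]expRK ler_ln ?posrE ?expR_gt0.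
have {Hx0} W := Hx0 x xx0 (fun p pp hp => nex (ex_intro _ p (conj pp hp))).
set V := log_weight (bad x) in W.
have V0 y : 0 <= V y by apply: log_weight_ge0.
pose L := truncn (ln x / ln B).
have lxB : 4 <= ln x / ln B by rewrite ler_pdivlMr.
have L4 : (4 <= L)%N by rewrite truncn_ge_nat // (le_trans _ lxB).
have w0 : 0 <= ln x / ln B by apply: le_trans lxB.
have [K LK] : exists K, L = K.+1 by exists L.-1; rewrite (ltn_predK L4).
have BL : B ^+ K.+1 <= x.
  rewrite -ler_ln ?posrE ?exprn_gt0 // lnXn // -mulr_natl -LK -ler_pdivlMr //.
  by rewrite truncn_le.
have xK : ln x / ln B < K%:R + 2.
  by have := truncnS_gt (ln x / ln B); rewrite -/L LK -!natr1; clear -s0; lra.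
have far i : (0 < i)%N -> s < (V (B ^+ i.+1) - V (B ^+ i)) +
    (V (x / B ^+ i.-1) - V (x / B ^+ i.+1)).
  move=> i0; rewrite ltNge; apply/negP => H.
  have lBi : lam <= B ^+ i.
    apply: (le_trans lamB); apply: ler_eXnr => //; exact: (le_trans l1 lamB).
  apply: (chain_contradiction x_gt0 lBi sr).
  rewrite /= -BE -exprSr; apply: le_trans H; rewrite lerD2l lerD2r.
  apply: log_weight_nd; rewrite -(prednK i0) exprS /=.
  have Bi0 : 0 < B ^+ i.-1 by apply: exprn_gt0.
  rewrite ler_pdivrMr; last exact: mulr_gt0.
  have -> : x / B ^+ i.-1 * (B * B ^+ i.-1) = B * x by field; rewrite gt_eqF.
  by rewrite ler_pM2r.
have Vnd := @log_weight_nd R (bad x).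
(* The windows telescope. The dual ones overlap in pairs, so the total is at most [3 * V (3 * x)], a
   quarter of [s * (ln x / ln B)]. *)
have sumK k : (k <= K)%N -> s * k%:R <= V (B ^+ k.+1) - V B +
    (V x + V (x / B)) - (V (x / B ^+ k) + V (x / B ^+ k.+1)).
  elim: k => [_|k IH kK]; first by rewrite mulr0 expr1 expr0 divr1; clear -s0; lra.
  have := IH (ltnW kK); have := far k.+1 isT; rewrite /= -natr1; clear -x_gt0; lra.
have B1 : 1 <= B := le_trans l1 lamB.
have := sumK K (leqnn _).
have x3 : x <= 3 * x by clear -x_gt0; lra.
have v1 : V (B ^+ K.+1) <= V (3 * x) by apply: Vnd; apply: le_trans x3.
have v2 : V x <= V (3 * x) by apply: Vnd.
have v3 : V (x / B) <= V (3 * x) by apply: Vnd; apply: le_trans x3; rewrite ler_pdivrMr // ler_peMr // ltW.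
have := V0 B; have := V0 (x / B ^+ K); have := V0 (x / B ^+ K.+1).
have E : 200 * e / s * ln x = s / 12 * (ln x / ln B).
  by rewrite /e; field; rewrite !gt_eqF.
rewrite E in W; move: (ln x / ln B) lxB xK W => w w4 wK W u1 u2 u3 HK.
have : s * (w - 2) <= s * K%:R by rewrite ler_pM2l // lerBlDr ltW.
have : s * 4 <= s * w by rewrite ler_pM2l.
by clear -v1 v2 v3 u1 u2 u3 W HK s0; lra.
Qed.

End PrimesInShortIntervals.

(** * Polynomial maps of bounded degree on every line *)

Section NormForm.
Variable p : nat.
Hypothesis p_pr : prime p.
Import VectorInternalTheory.

Lemma horner_char_poly (K : comNzRingType) n (A : 'M[K]_n) (a : K) :
  (char_poly A).[a] = \det (a%:M - A).
Proof.
rewrite -horner_evalE -det_map_mx; congr (\det _); apply/matrixP => i j.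
by rewrite !mxE /= horner_evalE hornerD hornerN hornerC hornerMn hornerX.
Qed.

(* [N] is the norm of the extension of degree [i] of F_p, expressed as the
   determinant of the multiplication map. *)
Lemma norm_form i : (0 < i)%N -> exists N : 'rV['F_p]_i -> 'F_p,
  forall y v, v != 0 -> exists P : {poly 'F_p},
    size P = i.+1 /\ forall a, P.[a] = N (y + a *: v).
Proof.
move=> i0; have [K pK cK] := pPrimePowerField p_pr i0.
pose L : falgType 'F_p := pPrimeCharType pK.
have dL : dim L = i.
  have := pprimeChar_dimf pK; rewrite dimvf => ->.
  by rewrite [#|_|]cK pfactorK.
rewrite -{i0 cK}dL.
pose M (w : 'rV['F_p]_(dim L)) : 'M['F_p]_(dim L) := lin1_mx (v2r \o (r2v w \*o r2v)).
have ME w u : u *m M w = v2r (r2v w * r2v u :> L) by rewrite mul_rV_lin1.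
have Mlin y a v : M (y + a *: v) = M y + a *: M v.
  apply/row_matrixP => k; rewrite linearD linearZ /= !rowE !ME.
  have -> : r2v (y + a *: v) = r2v y + a *: r2v v :> L by rewrite linearD /= linearZ.
  by rewrite mulrDl -scalerAl linearD linearZ.
have Munit v : v != 0 -> M v \in unitmx.
  move=> v0; have rv0 : r2v v != 0 :> L.
    by apply: contraNneq v0 => /(congr1 v2r); rewrite r2vK linear0 => ->.
  have : M v *m M (v2r ((r2v v : pPrimeCharType pK)^-1)) = 1%:M.
    apply/row_matrixP => k; rewrite !rowE mulmxA !ME !v2rK mulmx1 mulKf // r2vK //.
  by move/mulmx1_unit => -[Mv _]; exact: Mv.
exists (fun w => \det (M w)) => y v v0.
have Mv := Munit v v0.
have dv : \det (M v) != 0 by move: Mv; rewrite unitmxE unitfE.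
(* Factoring [M v] out of [M y + a *: M v] leaves a characteristic polynomial in [a], of degree
   exactly the dimension. *)
exists (\det (M v) *: char_poly (- (invmx (M v) *m M y))); split.
  by rewrite size_scale // size_char_poly.
move=> a; rewrite hornerZ horner_char_poly -det_mulmx Mlin opprK mulmxDr mulmxA mulmxV // mul1mx.
by rewrite mul_mx_scalar addrC.
Qed.

(* Along every line, [f] is a polynomial of degree between [2] and [k]; so the
   graph of [f] meets every line in at most [k] points. *)
Definition line_degree_between d (f : 'rV['F_p]_d -> 'F_p) k :=
  forall y v, v != 0 -> exists P : {poly 'F_p},
    (2 < size P <= k.+1)%N /\ forall a, P.[a] = f (y + a *: v).

(** Each step adds a norm form in a new block of variables. Along a direction that vanishes on this
    block the norm is constant; otherwise its degree exceeds that of the rest, so nothing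
    cancels. *)
Lemma line_degree_sum k : (0 < k)%N ->
  exists f : 'rV['F_p]_('C(k.+1, 2).-1) -> 'F_p, line_degree_between f k.
Proof.
elim: k => [//|[|k] IH _].
  (* For [k = 1] there are no variables, hence no nonzero direction. *)
  by exists (fun _ => 0) => y v; rewrite thinmx0 eqxx.
have [f Hf] := IH isT; have [N HN] := norm_form (ltn0Sn k.+1).
have -> : ('C(k.+3, 2).-1 = 'C(k.+2, 2).-1 + k.+2)%N.
  have : (0 < 'C(k.+2, 2))%N by rewrite bin_gt0.
  by rewrite [in LHS]binS bin1; case: ('C(k.+2, 2)) => // c _; rewrite addSn.
exists (fun y => f (lsubmx y) + N (rsubmx y)) => y v v0.
have E a : (fun y => f (lsubmx y) + N (rsubmx y)) (y + a *: v) =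
   f (lsubmx y + a *: lsubmx v) + N (rsubmx y + a *: rsubmx v).
  by rewrite !linearD !linearZ.
have [vr0|vr] := eqVneq (rsubmx v) 0.
  have vl : lsubmx v != 0.
    by apply: contraNneq v0 => vl0; rewrite -[v]hsubmxK vl0 vr0 row_mx0.
  have [P [/andP[P2 Pk] HP]] := Hf (lsubmx y) _ vl.
  exists (P + (N (rsubmx y))%:P); split.
    rewrite size_polyDl; first by rewrite P2 ltnW.
    by apply: leq_ltn_trans (size_polyC_leq1 _) _; apply: ltn_trans P2.
  by move=> a; rewrite hornerD hornerC HP E vr0 scaler0 addr0.
have [Q [Qs HQ]] := HN (rsubmx y) _ vr.
have [P [Ps HP]] : exists P : {poly 'F_p}, (size P <= k.+2)%N /\
    forall a, P.[a] = f (lsubmx y + a *: lsubmx v).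
  have [vl0|vl] := eqVneq (lsubmx v) 0.
    exists (f (lsubmx y))%:P; split; first by apply: leq_trans (size_polyC_leq1 _) _.
    by move=> a; rewrite hornerC vl0 scaler0 addr0.
  by have [P [/andP[_ Pk] HP]] := Hf (lsubmx y) _ vl; exists P.
exists (P + Q); split; last by move=> a; rewrite hornerD HP HQ E.
by rewrite addrC size_polyDl Qs ?ltnS // leqnn.
Qed.

Lemma line_degree_form k d : (0 < k)%N -> (d < 'C(k.+1, 2))%N ->
  exists f : 'rV['F_p]_d -> 'F_p, line_degree_between f k.
Proof.
move=> k0 dk; have [f Hf] := line_degree_sum k0.
set D := 'C(k.+1, 2).-1 in f Hf.
have dD : (d <= D)%N by rewrite /D; case: 'C(k.+1, 2) dk.
(* [pid_mx d] pads a vector with zeros; it is injective, so nonzero directions stay nonzero. *)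
exists (fun y => f (y *m pid_mx d)) => y v v0.
have vd : v *m pid_mx d != 0 :> 'rV_D.
  apply: contraNneq v0 => /(congr1 (fun u : 'rV['F_p]_D => u *m (pid_mx d : 'M['F_p]_(D, d)))).
  by rewrite mul0mx -mulmxA pid_mx_id // pid_mx_1 mulmx1 => ->.
have [P [Ps HP]] := Hf (y *m pid_mx d) _ vd.
by exists P; split => // a; rewrite HP mulmxDl scalemxAl.
Qed.

End NormForm.

(** * Lower bound *)

Section IncidenceGraph.
Variables (L P : finType) (a b : nat) (inc : L -> P -> bool).

(** ['I_a] and ['I_b] are isolated vertices that pad the two parts to prescribed sizes. *)
Definition inc_vertex : finType := ((L + 'I_a) + (P + 'I_b))%type.

Definition inc_edge : rel inc_vertex := fun u v =>
  match u, v with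
  | inl (inl l), inr (inl x) | inr (inl x), inl (inl l) => inc l x
  | _, _ => false
  end.

Lemma inc_edge_sym : symmetric inc_edge.
Proof. by move=> [[?|?]|[?|?]] [[?|?]|[?|?]]. Qed.

Lemma inc_edge_irrefl : irreflexive inc_edge.
Proof. by move=> [[?|?]|[?|?]]. Qed.

Definition inc_graph := SGraph inc_edge_sym inc_edge_irrefl.

Lemma inc_graph_bipartite : bipartite (#|L| + a) (#|P| + b) inc_graph.
Proof.
exists [set u : inc_vertex | if u is inl _ then true else false]%SET; split.
- rewrite -[X in (#|L| + X)%N]card_ord -card_sum.
  rewrite -[RHS](card_codom (@inl_inj (L + 'I_a)%type (P + 'I_b)%type)).
  apply: eq_card => -[u|u]; rewrite inE; first by rewrite codom_f.
  by apply/esym/negbTE/codomP => -[].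
- rewrite -[X in (#|P| + X)%N]card_ord -card_sum.
  rewrite -[RHS](card_codom (@inr_inj (L + 'I_a)%type (P + 'I_b)%type)).
  apply: eq_card => -[u|u]; rewrite !inE; last by rewrite codom_f.
  by apply/esym/negbTE/codomP => -[].
- by move=> [[?|?]|[?|?]] [[?|?]|[?|?]] //=; rewrite !inE.
Qed.

Lemma inc_graph_card (S : finType) (l : S -> L) (x : S -> P) :
  injective (fun s => (l s, x s)) -> (forall s, inc (l s) (x s)) ->
  (#|S| <= #|edge_set inc_graph|)%N.
Proof.
move=> inj Hinc.
pose g s : {set inc_graph} := [set inl (inl (l s)); inr (inl (x s))]%SET.
rewrite -(@card_imset _ _ g); last first.
  move=> s s' /setP E; apply: inj.
  have := E (inl (inl (l s))); rewrite !inE eqxx /= => /esym.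
  rewrite orbF => /eqP[->].
  by have := E (inr (inl (x s))); rewrite !inE eqxx /= => /esym/eqP[->].
apply/subset_leq_card/fintype.subsetP => e /imsetP[s _ ->].
by apply/imsetP; exists (inl (inl (l s)), inr (inl (x s))); rewrite ?inE //= Hinc.
Qed.

Lemma inc_edgelP l (v : inc_vertex) : inc_edge (inl l) v ->
  exists l0 x, [/\ l = inl l0, v = inr (inl x) & inc l0 x].
Proof. by case: l => [l0|//]; case: v => [[]|[x|]] //= H; exists l0, x. Qed.

Lemma inc_edgerP x (v : inc_vertex) : inc_edge (inr x) v ->
  exists x0 l, [/\ x = inl x0, v = inl (inl l) & inc l x0].
Proof. by case: x => [x0|//]; case: v => [[l|]|[]] //= H; exists x0, l. Qed.

Lemma inc_graph_C4_free :
  (forall l l' x x', l != l' -> x != x' ->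
    inc l x -> inc l x' -> inc l' x -> inc l' x' -> False) ->
  ~ subgraph (cycle_graph 4) inc_graph.
Proof.
move=> H [f [finj fe]].
pose i0 : cycle_graph 4 := @Ordinal 4 0 isT.
pose i1 : cycle_graph 4 := @Ordinal 4 1 isT.
pose i2 : cycle_graph 4 := @Ordinal 4 2 isT.
pose i3 : cycle_graph 4 := @Ordinal 4 3 isT.
have e01 : inc_edge (f i0) (f i1) by apply: fe.
have e12 : inc_edge (f i1) (f i2) by apply: fe.
have e23 : inc_edge (f i2) (f i3) by apply: fe.
have e30 : inc_edge (f i3) (f i0) by apply: fe.
have n02 : f i0 != f i2 by apply/eqP => /finj.
have n13 : f i1 != f i3 by apply/eqP => /finj.
case: (f i0) e01 e30 n02 => [l|x] e01 e30 n02.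
  have [l0 [x1 [E0 E1 I01]]] := inc_edgelP e01.
  move: e12 n13; rewrite E1 => /inc_edgerP[_ [l2 [[<-] E2 I12]]] n13.
  move: e23 n02; rewrite E2 => /inc_edgelP[_ [x3 [[<-] E3 I23]]] n02.
  move: e30 n13 n02; rewrite E3 E0 /= => I30 n13 n02.
  exact: (H l0 l2 x1 x3).
have [x0 [l1 [E0 E1 I01]]] := inc_edgerP e01.
move: e12 n13; rewrite E1 => /inc_edgelP[_ [x2 [[<-] E2 I12]]] n13.
move: e23 n02; rewrite E2 => /inc_edgerP[_ [l3 [[<-] E3 I23]]] n02.
move: e30 n13 n02; rewrite E3 E0 /= => I30 n13 n02.
exact: (H l1 l3 x0 x2).
Qed.

(** The ends of the theta graph are a line [l] and a point [x]. In either order the paths give [t]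
    lines through [x] that meet [l] in distinct points. *)
Lemma inc_graph_theta_free t : (0 < t)%N ->
  (forall (l : L) (x : P) (ls : 'I_t -> L) (xs : 'I_t -> P), injective xs ->
    (forall i, [/\ ls i != l, xs i != x, inc (ls i) x, inc (ls i) (xs i) & inc l (xs i)]) -> False) ->
  ~ subgraph (theta_graph 3 t) inc_graph.
Proof.
move=> t0 H [f [finj fe]].
pose u i : theta_graph 3 t := inr (i, @Ordinal 2 0 isT).
pose v i : theta_graph 3 t := inr (i, @Ordinal 2 1 isT).
pose c : theta_graph 3 t := inl false.
pose d : theta_graph 3 t := inl true.
have ecu i : inc_edge (f c) (f (u i)) by apply: fe.
have euv i : inc_edge (f (u i)) (f (v i)) by apply: fe; rewrite /= /theta_edge /= eqxx.
have evd i : inc_edge (f (v i)) (f d) by apply: fe.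
have ncv i : f (v i) != f c by apply/eqP => /finj.
have nud i : f (u i) != f d by apply/eqP => /finj.
have uinj : injective (fun i => f (u i)) by move=> i k /finj[].
have vinj : injective (fun i => f (v i)) by move=> i k /finj[].
case: (f c) ecu ncv => [l|x] ecu ncv.
  have Hx i : exists x, f (u i) = inr (inl x).
    by have [l0 [x [_ -> _]]] := inc_edgelP (ecu i); exists x.
  have [xs xsE] := choice Hx.
  have Hl i : exists l, f (v i) = inl (inl l).
    by have := euv i; rewrite xsE => /inc_edgerP[_ [l' [_ -> _]]]; exists l'.
  have [ls lsE] := choice Hl.
  have [l0 lE] : exists l0, l = inl l0.
    by have [l0 [x [-> _ _]]] := inc_edgelP (ecu (Ordinal t0)); exists l0.
  have [x dE] : exists x, f d = inr (inl x).
    by have := evd (Ordinal t0); rewrite lsE => /inc_edgelP[_ [x [_ -> _]]]; exists x.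
  apply: (H l0 x ls xs) => [i k E|i]; first by apply: uinj; rewrite /= !xsE E.
  have := (ecu i, euv i, evd i); have := (ncv i, nud i).
  by rewrite lE dE xsE lsE => -[? ?] [[? ?] ?]; split.
have Hl i : exists l, f (u i) = inl (inl l).
  by have [x0 [l [_ -> _]]] := inc_edgerP (ecu i); exists l.
have [ls lsE] := choice Hl.
have Hx i : exists x, f (v i) = inr (inl x).
  by have := euv i; rewrite lsE => /inc_edgelP[_ [x' [_ -> _]]]; exists x'.
have [xs xsE] := choice Hx.
have [x0 xE] : exists x0, x = inl x0.
  by have [x0 [l [-> _ _]]] := inc_edgerP (ecu (Ordinal t0)); exists x0.
have [l dE] : exists l, f d = inl (inl l).
  by have := evd (Ordinal t0); rewrite xsE => /inc_edgerP[_ [l [_ -> _]]]; exists l.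
apply: (H l x0 ls xs) => [i k E|i]; first by apply: vinj; rewrite /= !xsE E.
have := (ecu i, euv i, evd i); have := (ncv i, nud i).
by rewrite xE dE xsE lsE => -[? ?] [[? ?] ?]; split.
Qed.

End IncidenceGraph.

(** * The point-line geometry with directions on the graph of a function *)

Section LinearRepresentation.
Variables (p t d : nat).
Hypothesis p_pr : prime p.
Variable f : 'rV['F_p]_d -> 'F_p.
Hypothesis f_deg : line_degree_between f t.

(* The point [(s, q, r)] of F_p^(d+2) lies on the line through [(0, u, w)] with
   direction [(1, y, f y)]. *)
Definition lr_inc (l : 'rV['F_p]_d * 'rV['F_p]_d * 'F_p)
    (x : 'F_p * 'rV['F_p]_d * 'F_p) : bool :=
  let: (y, u, w) := l in let: (s, q, r) := x in
  (q == u + s *: y) && (r == w + s * f y).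

(** Distinct points of one line differ in the first coordinate; two of them determine [y], then [u]
    and [w]. *)
Lemma lr_inc_partial_linear l l' x x' : l != l' -> x != x' ->
  lr_inc l x -> lr_inc l x' -> lr_inc l' x -> lr_inc l' x' -> False.
Proof.
move: l l' x x' => [[y u] w] [[y' u'] w'] [[s q] r] [[s' q'] r'] nl nx.
move=> /andP[/eqP qE /eqP rE] /andP[/eqP E1 /eqP E2].
move=> /andP[/eqP E3 /eqP E4] /andP[/eqP E5 /eqP E6].
have ss : s != s' by apply: contraNneq nx => E; rewrite E1 E2 qE rE E.
rewrite qE rE in E3 E4; rewrite E1 E2 in E5 E6.
have yy : y = y'.
  have : (s - s') *: (y - y') = 0.
    have A : s *: y = u' + s *: y' - u by rewrite -E3 addrC addKr.
    have B : s' *: y = u' + s' *: y' - u by rewrite -E5 addrC addKr.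
    by rewrite scalerBl !scalerBr A B; apply/rowP => k; rewrite !mxE; ring.
  by move/eqP; rewrite scaler_eq0 !subr_eq0 (negbTE ss) => /eqP.
move: nl; rewrite -yy in E3 E4 *; rewrite (addIr _ E3) (addIr _ E4).
by rewrite eqxx.
Qed.

Lemma lr_inc_theta l x (ls : 'I_t -> _) (xs : 'I_t -> _) : (0 < t)%N -> injective xs ->
  (forall i, [/\ ls i != l, xs i != x, lr_inc (ls i) x, lr_inc (ls i) (xs i) & lr_inc l (xs i)]) ->
  False.
Proof.
move=> t0 xinj H; case: l H => [[y u] w] H; case: x H => [[s0 q0] r0] H.
pose s i := (xs i).1.1; pose yy i := (ls i).1.1.
(* [(0, v, c)] is the point of [l] with first coordinate [s0] minus [x]. Comparing both lines
   through [xs i] shows that [(yy i - y, f (yy i) - f y)] is [(v, c)] divided by [s i - s0]. *)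
pose v := u + s0 *: y - q0; pose c := w + s0 * f y - r0.
have sinj : injective s.
  move=> i k E; apply: xinj; have [_ _ _ _] := H i; have [_ _ _ _] := H k.
  move: E; rewrite /s; case: (xs i) => [[a b] e]; case: (xs k) => [[a' b'] e'] /= ->.
  by move=> /andP[/eqP-> /eqP->] /andP[/eqP-> /eqP->].
have s_neq i : s i - s0 != 0.
  rewrite subr_eq0; have [_ + + + _] := H i; rewrite /s.
  case: (xs i) => [[a b] e]; case: (ls i) => [[y1 u1] w1] /= nx.
  move=> /andP[/eqP E1 /eqP E2] /andP[/eqP E3 /eqP E4].
  by apply: contraNneq nx => E; rewrite E3 E4 E1 E2 E.
have yyE i : (s i - s0) *: (yy i - y) = v.
  have [_ _ + + +] := H i; rewrite /s /yy.
  case: (xs i) => [[a b] e]; case: (ls i) => [[y1 u1] w1] /=.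
  move=> /andP[/eqP E1 _] /andP[/eqP E3 _] /andP[/eqP E5 _].
  rewrite /v E1; apply/rowP => k.
  have := congr1 (fun z : 'rV_d => z 0 k) E3; have := congr1 (fun z : 'rV_d => z 0 k) E5.
  rewrite !mxE => -> E.
  have -> : u 0 k = u1 0 k + a * y1 0 k - a * y 0 k by rewrite -E addrK.
  ring.
have fyE i : (s i - s0) * (f (yy i) - f y) = c.
  have [_ _ + + +] := H i; rewrite /s /yy.
  case: (xs i) => [[a b] e]; case: (ls i) => [[y1 u1] w1] /=.
  move=> /andP[_ /eqP E1] /andP[_ /eqP E3] /andP[_ /eqP E5].
  have -> : c = w + s0 * f y - (w1 + s0 * f y1) by rewrite -E1.
  have -> : w = w1 + a * f y1 - a * f y by rewrite -E3 E5 addrK.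
  ring.
(* Otherwise [ls i] has the direction of [l] and meets it, hence equals [l]. *)
have v0 : v != 0.
  apply/eqP => v0; pose i := Ordinal t0.
  have yi : yy i = y.
    have /eqP := yyE i; rewrite v0 scaler_eq0 (negbTE (s_neq i)) subr_eq0 => /eqP //.
  have [+ _ + + +] := H i; move: yi; rewrite /yy; clear -v0.
  case: (xs i) => [[a b] e]; case: (ls i) => [[y1 u1] w1] /= ->.
  move=> nl /andP[/eqP E1 _] /andP[_ /eqP E3] /andP[_ /eqP E5].
  move: nl; have -> : u1 = u.
    by apply: (addIr (s0 *: y)); rewrite -E1; apply/eqP; rewrite eq_sym -subr_eq0 -/v v0.
  have -> : w1 = w by apply: (addIr (a * f y)); rewrite -E3 -E5.
  by rewrite eqxx.
(* [f (y + a v) = f y + a c] holds for [a = 0] and for the [t] distinct values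
   [a = (s i - s0)^-1]. *)
have [P [/andP[P2 Pt] PE]] := f_deg y v0.
(* [P] has degree at least 2, so subtracting a polynomial of degree at most 1 leaves [Q] nonzero of
   degree at most [t], too small for [t + 1] roots. *)
pose Q := P - ((f y)%:P + c *: 'X).
have sz1 : (size ((f y)%:P + c *: 'X)%R < size P)%N.
  apply: leq_ltn_trans P2; apply: leq_trans (size_polyD _ _) _.
  rewrite geq_max (leq_trans (size_polyC_leq1 _)) //=.
  by apply: leq_trans (size_scale_leq _ _) _; rewrite size_polyX.
have sQ : size Q = size P by rewrite size_polyDl // size_polyN.
have Q0 : Q != 0 by rewrite -size_poly_gt0 sQ (leq_trans _ P2).
pose tau i := (s i - s0)^-1.
have tinj : injective tau by move=> i k /invr_inj/addIr/sinj.
have := @max_poly_roots _ Q (0 :: [seq tau i | i : 'I_t]) Q0.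
rewrite /= size_map size_enum_ord sQ ltnNge Pt /= => Hr; suff : false by [].
apply: Hr; last first.
  rewrite map_inj_uniq // enum_uniq andbT; apply/negP => /mapP[i _ /esym/eqP].
  by rewrite invr_eq0 (negbTE (s_neq i)).
apply/andP; split.
  by rewrite /root !hornerE PE scale0r addr0 subrr.
apply/allP => _ /mapP[i _ ->]; rewrite /root !hornerE PE.
have -> : y + tau i *: v = yy i.
  by rewrite -(yyE i) scalerA mulVf ?s_neq // scale1r addrC subrK.
have -> : c * tau i = f (yy i) - f y by rewrite -(fyE i) mulrAC mulfV ?s_neq // mul1r.
by rewrite [f y + _]addrC subrK subrr.
Qed.

Lemma ex_bip_linear_representation (n m : nat) : (0 < t)%N ->
  (p ^ (d.*2.+1) <= n)%N -> (p ^ d.+2 <= m)%N ->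
  (p ^ (d.+1.*2) <= ex_bip n m
     (fun H => H = cycle_graph 4 \/ H = theta_graph 3 t))%N.
Proof.
move=> t0 pn pm.
have cF : #|{: 'F_p}| = p by rewrite card_Fp.
have cV : #|{: 'rV['F_p]_d}| = (p ^ d)%N by rewrite card_mx mul1n cF.
have cL : #|{: 'rV['F_p]_d * 'rV['F_p]_d * 'F_p}| = (p ^ d.*2.+1)%N.
  by rewrite !card_prod cF cV -expnD addnn -expnSr.
have cP : #|{: 'F_p * 'rV['F_p]_d * 'F_p}| = (p ^ d.+2)%N.
  by rewrite !card_prod cF cV -expnS -expnSr.
pose G := inc_graph (n - p ^ d.*2.+1) (m - p ^ d.+2) lr_inc.
have bG : bipartite n m G.
  by have := inc_graph_bipartite (n - p ^ d.*2.+1) (m - p ^ d.+2) lr_inc; rewrite cL cP !subnKC.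
have fG : graph_free (fun H => H = cycle_graph 4 \/ H = theta_graph 3 t) G.
  move=> _ [] ->; first exact/inc_graph_C4_free/lr_inc_partial_linear.
  by apply: inc_graph_theta_free => // l x ls xs; apply: lr_inc_theta.
apply: leq_trans (leq_ex_bip bG fG).
(* A line has exactly one point for each first coordinate, so the incidences are indexed by a line
   and an element of ['F_p]. *)
have -> : (p ^ d.+1.*2 = #|{: ('rV['F_p]_d * 'rV['F_p]_d * 'F_p) * 'F_p}|)%N.
  by rewrite card_prod cL cF doubleS expnSr.
apply: (@inc_graph_card _ _ _ _ _ _ (fun z => z.1)
   (fun z => (z.2, z.1.1.2 + z.2 *: z.1.1.1, z.1.2 + z.2 * f z.1.1.1))).
- by move=> [l s] [l' s'] [] -> ->.
- by move=> [[[y u] w] s] /=; rewrite !eqxx.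
Qed.

End LinearRepresentation.

(** * Upper bound *)

Section UpperBound.
Variables (G : sgraph) (A : {set G}).
Hypothesis bipA : forall x y : G, edge x y -> (x \in A) != (y \in A).

Lemma C4_subgraph (w0 w1 w2 w3 : G) : w0 != w2 -> w1 != w3 ->
  edge w0 w1 -> edge w1 w2 -> edge w2 w3 -> edge w3 w0 ->
  subgraph (cycle_graph 4) G.
Proof.
move=> n02 n13 e01 e12 e23 e30.
have adj x y : edge x y -> (x != y :> G).
  by move=> exy; apply: contraTneq exy => ->; rewrite edge_irrefl.
exists (fun i : 'I_4 => nth w0 [:: w0; w1; w2; w3] i); split.
  move=> i j /eqP; rewrite nth_uniq ?ltn_ord //= => [/eqP/val_inj //|].
  rewrite !inE !negb_or (adj _ _ e01) (adj _ _ e12) (adj _ _ e23) n02 n13 eq_sym.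
  by rewrite (adj _ _ e30).
move=> [[|[|[|[|//]]]] ?] [[|[|[|[|//]]]] ?] //=; rewrite /cycle_edge -?val_eqE //= => _.
all: by rewrite // edge_sym.
Qed.

Definition deg (x : G) : nat := #|[set y : G | edge x y]%SET|.

(* The edges, oriented from [A] to its complement. *)
Definition cross : pred (G * G) := fun ab => (ab.1 \in A) && edge ab.1 ab.2.

Lemma card_edge_set_cross : (#|edge_set G| <= #|cross|)%N.
Proof.
apply: leq_trans (leq_imset_card (fun p : G * G => [set p.1; p.2]%SET) _).
apply/subset_leq_card/fintype.subsetP => e /imsetP[[x y]].
rewrite inE /= => xy ->; have := bipA xy.
case xA: (x \in A); case yA: (y \in A) => // _.
  by apply/imsetP; exists (x, y); rewrite // unfold_in /= xA.
apply/imsetP; exists (y, x); last exact: finset.setUC.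
by rewrite unfold_in /= yA edge_sym.
Qed.

(* Counts the paths [x - b - a - y] of length 3 by their middle edge: without [C4],
   distinct paths with the same ends are internally disjoint, so fewer than [t] of
   them share both ends. *)
Lemma three_path_bound (t : nat) : (0 < t)%N ->
  ~ subgraph (cycle_graph 4) G -> ~ subgraph (theta_graph 3 t) G ->
  (\sum_(ab | cross ab) (deg ab.1).-1 * (deg ab.2).-1 <= t.-1 * (#|A| * #|~: A|))%N.
Proof.
move=> t0 noC4 noTheta.
pose R (ab xy : G * G) := [&& edge ab.2 xy.1, xy.1 != ab.1, edge ab.1 xy.2 & xy.2 != ab.2].
have E ab : cross ab -> ((deg ab.1).-1 * (deg ab.2).-1 = \sum_(xy | R ab xy) 1)%N.
  case: ab => a b /andP[/= aA eab]; rewrite sum1_card mulnC.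
  have -> : (deg b).-1 = #|([set x : G | edge b x] :\ a)%SET|.
    by rewrite /deg (cardsD1 a) inE edge_sym eab.
  have -> : (deg a).-1 = #|([set x : G | edge a x] :\ b)%SET|.
    by rewrite /deg (cardsD1 b) inE eab.
  rewrite -cardsX; apply: eq_card => -[x y].
  by rewrite !inE unfold_in /R /=; do !case: (_ != _); do !case: (edge _ _).
rewrite (eq_bigr _ E).
rewrite (exchange_big_dep (fun xy : G * G => (xy.1 \in A) && (xy.2 \in ~: A))) /=; last first.
  move=> [a b] [x y] /andP[/= aA eab] /and4P[/= ebx _ eay _].
  have := bipA eab; have := bipA ebx; have := bipA eay; rewrite aA inE.
  by case: (y \in A); case: (b \in A); case: (x \in A).
apply: (@leq_trans (\sum_(xy : G * G | (xy.1 \in A) && (xy.2 \in ~: A)) t.-1)); last first.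
  rewrite sum_nat_const mulnC leq_mul2l -cardsX; apply/orP; right.
  by apply/eq_leq/eq_card => -[x y]; rewrite !inE unfold_in /= inE.
apply: leq_sum => -[x y] /andP[/= xA yA].
rewrite sum1_card leqNgt; apply/negP => big.
set S := (X in #|X|) in big.
have tS : (t <= #|S|)%N by rewrite -(prednK t0).
pose g (i : 'I_t) : G * G := enum_val (widen_ord tS i).
have ginj : injective g by move=> i k /enum_val_inj/(congr1 val)/=/val_inj.
have gS i : [/\ (g i).1 \in A, edge (g i).1 (g i).2, edge (g i).2 x &
     [/\ x != (g i).1, edge (g i).1 y & y != (g i).2]].
  by have := enum_valP (widen_ord tS i); rewrite unfold_in => /andP[/andP[? ?] /and4P[? ? ? ?]].
have ainj : injective (fun i => (g i).1).
  move=> i k E1; apply: ginj; rewrite [g i]surjective_pairing [g k]surjective_pairing E1.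
  congr pair; apply/eqP/negPn/negP => n12; apply: noC4.
  have [_ e1 e2 [n1 _ _]] := gS i; have [_ e3 e4 [_ _ _]] := gS k.
  apply: (@C4_subgraph x (g i).2 (g i).1 (g k).2) => //; try by rewrite edge_sym.
  by rewrite E1.
have binj : injective (fun i => (g i).2).
  move=> i k E1; apply: ginj; rewrite [g i]surjective_pairing [g k]surjective_pairing E1.
  congr pair; apply/eqP/negPn/negP => n12; apply: noC4.
  have [_ e1 _ [_ e2 n1]] := gS i; have [_ e3 _ [_ e4 _]] := gS k.
  apply: (@C4_subgraph y (g i).1 (g i).2 (g k).1) => //; try by rewrite edge_sym.
  by rewrite E1 edge_sym.
have bA i : (g i).2 \notin A.
  by have [aA e1 _ [_ _ _]] := gS i; have := bipA e1; rewrite aA; case: (_ \in A).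
have aA i : (g i).1 \in A by have [] := gS i.
have yA' : y \notin A by move: yA; rewrite inE.
apply: noTheta; exists (fun u : theta_vertex 3 t =>
  match u with inl b => if b then y else x
  | inr (i, q) => if val q == 0%N then (g i).2 else (g i).1 end); split.
  have AB z w : z \in A -> w \notin A -> z <> w by move=> zA wA zw; move: wA; rewrite -zw zA.
  move=> [[|]|[i [[|[|//]] ?]]] [[|]|[k [[|[|//]] ?]]] //=.
  - by move/esym/(AB _ _ xA yA').
  - by have [_ _ _ [_ _ n1]] := gS k; move=> E1; rewrite E1 eqxx in n1.
  - by move/esym/(AB _ _ (aA k) yA').
  - by move/(AB _ _ xA yA').
  - by move/(AB _ _ xA (bA k)).
  - by have [_ _ _ [n1 _ _]] := gS k; move=> E1; rewrite E1 eqxx in n1.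
  - by have [_ _ _ [_ _ n1]] := gS i; move=> E1; rewrite E1 eqxx in n1.
  - by move/esym/(AB _ _ xA (bA i)).
  - by move/binj => ->; congr (inr (_, _)); apply: val_inj.
  - by move/esym/(AB _ _ (aA k) (bA i)).
  - by move/(AB _ _ (aA i) yA').
  - by have [_ _ _ [n1 _ _]] := gS i; move=> E1; rewrite E1 eqxx in n1.
  - by move/(AB _ _ (aA i) (bA k)).
  - by move/ainj => ->; congr (inr (_, _)); apply: val_inj.
move=> [[|]|[i [[|[|//]] ?]]] [[|]|[k [[|[|//]] ?]]] //=; rewrite /theta_edge //= ?andbF //.
- by have [_ _ _ [_ e1 _]] := gS k; rewrite edge_sym.
- by have [_ _ e1 [_ _ _]] := gS k; rewrite edge_sym.
- by have [_ _ e1 [_ _ _]] := gS i.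
- by rewrite andbT => /eqP->; have [_ e1 _ [_ _ _]] := gS k; rewrite edge_sym.
- by have [_ _ _ [_ e1 _]] := gS i.
- by rewrite andbT => /eqP->; have [_ e1 _ [_ _ _]] := gS k.
Qed.

(** * Weighted sums over edges and Hölder's inequality *)

Section Weighted.
Variable R : realType.

Lemma AGM3 (x y z : R) : 0 < x -> 0 < y -> 0 < z -> 1 <= x * y * z -> 3 <= x + y + z.
Proof.
move=> x0 y0 z0 xyz; rewrite leNgt; apply/negP => s3.
have h1 : 0 <= (x + y + z) * ((x - y) ^+ 2 + (y - z) ^+ 2 + (z - x) ^+ 2).
  by apply: mulr_ge0; [lra | rewrite !addr_ge0 ?sqr_ge0].
have h2 : 0 <= x * (y - z) ^+ 2 + y * (z - x) ^+ 2 + z * (x - y) ^+ 2.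
  by rewrite !addr_ge0 // mulr_ge0 ?sqr_ge0 // ltW.
(* The difference of the two sides is half the quantity in [h1] plus three times the one in [h2]. *)
have h3 : 27 * (x * y * z) <= (x + y + z) ^+ 3 by nra.
have s0 : 0 < x + y + z by lra.
have : (x + y + z) ^+ 3 < 3 ^+ 3 by rewrite ltrXn2r ?nnegrE ?(ltW s0) //.
by rewrite -[3%N]/(2 + 1)%N exprD expr1 expr2 => ?; lra.
Qed.

Lemma cross_sum1 (P : pred G) (F : G -> R) :
  \sum_(ab | cross ab && P ab.1) F ab.1 = \sum_(a in A | P a) (deg a)%:R * F a.
Proof.
rewrite [RHS](eq_bigr (fun a => \sum_(b | edge a b) F a)); last first.
  move=> a _; rewrite sumr_const -[RHS]mulr_natl; congr (_%:R * _).
  by apply: eq_card => b; rewrite inE.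
by rewrite pair_big_dep /=; apply: eq_bigl => -[a b]; rewrite /cross /= andbAC.
Qed.

Lemma cross_sum2 (P : pred G) (F : G -> R) :
  \sum_(ab | cross ab && P ab.2) F ab.2 = \sum_(b in ~: A | P b) (deg b)%:R * F b.
Proof.
rewrite [RHS](eq_bigr (fun b => \sum_(a | edge b a) F b)); last first.
  move=> b _; rewrite sumr_const -[RHS]mulr_natl; congr (_%:R * _).
  by apply: eq_card => a; rewrite inE.
rewrite (exchange_big_dep predT) //= pair_big_dep /=.
apply: eq_bigl => -[a b]; rewrite /cross /= inE edge_sym.
case e : (edge b a); rewrite ?andbF //; have := bipA e; rewrite !andbT.
by case: (a \in A); case: (b \in A).
Qed.

(** Edges with an end of degree below [K] are counted by the term with [K]. On the others [deg - 1]
    is at least [(1 - 1 / K) * deg], so [three_path_bound] controls the sum of the products of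
    degrees, and Hölder's inequality bounds their number by [X]. *)
Lemma cross_bound (t K : nat) (X : R) : (0 < t)%N -> (2 <= K)%N -> 0 < X ->
  ~ subgraph (cycle_graph 4) G -> ~ subgraph (theta_graph 3 t) G ->
  t.-1%:R * (#|A| * #|~: A|)%:R ^+ 2 <= (1 - K%:R^-1) ^+ 2 * X ^+ 3 ->
  #|edge_set G|%:R <= X + K%:R * (#|A| + #|~: A|)%:R.
Proof.
move=> t0 K2 X0 noC4 noTheta HX.
set nA := #|A| in HX *; set nB := #|~: A| in HX *.
have K0 : 0 < K%:R :> R by rewrite ltr0n ltnW.
pose P' (ab : G * G) := (K <= deg ab.1)%N && (K <= deg ab.2)%N.
have le1 : #|edge_set G|%:R <= \sum_(ab | cross ab) (1 : R).
  by rewrite sumr_const ler_nat card_edge_set_cross.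
apply: le_trans le1 _; rewrite (bigID P') /=; apply: lerD; last first.
  apply: (@le_trans _ _ (\sum_(ab | cross ab && (deg ab.1 < K)%N) 1 +
      \sum_(ab | cross ab && (deg ab.2 < K)%N) 1)).
    rewrite big_mkcond [X in _ <= X + _]big_mkcond [X in _ <= _ + X]big_mkcond -big_split /=.
    apply: ler_sum => ab _; rewrite /P' negb_and -!ltnNge.
    by case: (cross ab); case: (_ < K)%N; case: (_ < K)%N => //=; lra.
  rewrite (cross_sum1 (fun a => deg a < K)%N (fun _ => 1)).
  rewrite (cross_sum2 (fun a => deg a < K)%N (fun _ => 1)) natrD mulrDr.
  have B (S : {set G}) : \sum_(a in S | (deg a < K)%N) (deg a)%:R * (1 : R) <= K%:R * #|S|%:R.
    apply: (@le_trans _ _ (\sum_(a in S) K%:R)); last by rewrite sumr_const -[X in X <= _]mulr_natr.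
    rewrite [X in _ <= X](bigID (fun a => deg a < K)%N) /= -[X in X <= _]addr0; apply: lerD.
      by apply: ler_sum => a /andP[_ aK]; rewrite mulr1 ler_nat ltnW.
    by apply: sumr_ge0 => *; exact: ler0n.
  by apply: lerD; exact: B.
set Sum := \sum_(_ | _) _.
have [S0|SN0] := eqVneq Sum 0; first by rewrite S0 ltW.
have [[a0 b0] /andP[/andP[aA0 eab0] _]] : exists ab, cross ab && P' ab.
  apply: contrapT => nex; move: SN0; rewrite /Sum big_pred0 ?eqxx // => ab.
  by apply/negP => H; apply: nex; exists ab.
have nA0 : 0 < nA%:R :> R by rewrite ltr0n; apply/card_gt0P; exists a0.
have nB0 : 0 < nB%:R :> R.
  rewrite ltr0n; apply/card_gt0P; exists b0; have := bipA eab0.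
  by rewrite inE aA0; case: (b0 \in A).
have iK : 0 < (K%:R^-1 : R) <= 2^-1.
  by rewrite invr_gt0 K0 /= lef_pV2 ?posrE // ler_nat.
set q := 1 - K%:R^-1 in HX.
have q0 : 0 < q by rewrite /q; lra.
pose T := \sum_(ab | cross ab && P' ab) (deg ab.1)%:R * (deg ab.2)%:R : R.
have [U UE] : exists U : R, U = X ^+ 3 / (nA%:R * nB%:R) by eexists.
have U0 : 0 < U by rewrite UE divr_gt0 ?exprn_gt0 ?mulr_gt0.
have degq d : (K <= d)%N -> q * d%:R <= d.-1%:R :> R.
  move=> Kd; have d0 : (0 < d)%N := leq_trans (ltnW K2) Kd.
  have -> : d.-1%:R = d%:R - 1 :> R by rewrite -subn1 natrB.
  have : 1 <= K%:R^-1 * d%:R :> R by rewrite mulrC ler_pdivlMr // mul1r ler_nat.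
  by rewrite /q; lra.
have TU : T <= U.
  have q2T : q ^+ 2 * T <= t.-1%:R * (nA%:R * nB%:R).
    have := three_path_bound t0 noC4 noTheta.
    rewrite -(ler_nat R) natrM natr_sum natrM; apply: le_trans.
    rewrite /T mulr_sumr [X in _ <= X](bigID P') /= -[X in X <= _]addr0; apply: lerD; last first.
      by apply: sumr_ge0 => *; exact: ler0n.
    apply: ler_sum => -[a b] /andP[_ /andP[/= Ka Kb]].
    rewrite natrM; have := degq _ Ka; have := degq _ Kb => h1 h2.
    have -> : q ^+ 2 * ((deg a)%:R * (deg b)%:R) = (q * (deg a)%:R) * (q * (deg b)%:R) by ring.
    by apply: ler_pM => //; apply: mulr_ge0; rewrite ?ler0n ?(ltW q0).
  rewrite UE ler_pdivlMr ?mulr_gt0 // -(ler_pM2l (exprn_gt0 2 q0)).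
  apply: le_trans HX; rewrite natrM mulrA.
  have -> : t.-1%:R * (nA%:R * nB%:R) ^+ 2 = t.-1%:R * (nA%:R * nB%:R) * (nA%:R * nB%:R) :> R by ring.
  by rewrite ler_pM2r ?mulr_gt0.
have inv1 : \sum_(ab | cross ab && P' ab) ((deg ab.1)%:R)^-1 <= nA%:R :> R.
  apply: (@le_trans _ _ (\sum_(ab | cross ab && true) ((deg ab.1)%:R)^-1)).
    rewrite [X in _ <= X](bigID P') /= -[X in X <= _]addr0; apply: lerD.
      by under [X in _ <= X]eq_bigl => ab do rewrite andbT.
    by apply: sumr_ge0 => *; rewrite invr_ge0.
  rewrite (cross_sum1 predT (fun a => ((deg a)%:R)^-1)) /nA -sum1_card natr_sum.
  rewrite big_mkcondr /=; apply: ler_sum => a _.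
  by have [->|d0] := eqVneq (deg a) 0%N; rewrite ?mul0r // mulfV // pnatr_eq0.
have inv2 : \sum_(ab | cross ab && P' ab) ((deg ab.2)%:R)^-1 <= nB%:R :> R.
  apply: (@le_trans _ _ (\sum_(ab | cross ab && true) ((deg ab.2)%:R)^-1)).
    rewrite [X in _ <= X](bigID P') /= -[X in X <= _]addr0; apply: lerD.
      by under [X in _ <= X]eq_bigl => ab do rewrite andbT.
    by apply: sumr_ge0 => *; rewrite invr_ge0.
  rewrite (cross_sum2 predT (fun a => ((deg a)%:R)^-1)) /nB -sum1_card natr_sum.
  rewrite big_mkcondr /=; apply: ler_sum => a _.
  by have [->|d0] := eqVneq (deg a) 0%N; rewrite ?mul0r // mulfV // pnatr_eq0.
(* AM-GM: [3 <= X / U * d(a) d(b) + X / nA / d(a) + X / nB / d(b)], since the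
   product of the three terms is [1]. *)
have : 3 * Sum <= X / U * T + X / nA%:R * nA%:R + X / nB%:R * nB%:R.
  apply: (@le_trans _ _ (X / U * T +
     X / nA%:R * (\sum_(ab | cross ab && P' ab) ((deg ab.1)%:R)^-1) +
     X / nB%:R * (\sum_(ab | cross ab && P' ab) ((deg ab.2)%:R)^-1))).
    rewrite /Sum /T !mulr_sumr -!big_split /=; apply: ler_sum => -[a b] /andP[_ /andP[/= Ka Kb]].
    have da : 0 < (deg a)%:R :> R by rewrite ltr0n (leq_trans _ Ka) // ltnW.
    have db : 0 < (deg b)%:R :> R by rewrite ltr0n (leq_trans _ Kb) // ltnW.
    rewrite mulr1; apply: AGM3.
    - by rewrite mulr_gt0 ?divr_gt0 // mulr_gt0.
    - by rewrite divr_gt0 ?divr_gt0.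
    - by rewrite divr_gt0 ?divr_gt0.
    rewrite le_eqVlt; apply/orP; left; apply/eqP; rewrite UE; field.
    by rewrite !gt_eqF.
  by rewrite !lerD // ler_pM2l ?divr_gt0.
rewrite !divfK ?gt_eqF // => H3.
have : X / U * T <= X / U * U by rewrite ler_pM2l ?divr_gt0.
rewrite divfK ?gt_eqF //; lra.
Qed.

End Weighted.
End UpperBound.

(** * Asymptotics *)

Section PrimesNearBelow.
Variable R : realType.

Lemma bernoulli_le (s : R) k : 0 <= s <= 1 -> 1 - k%:R * s <= (1 - s) ^+ k.
Proof.
move=> /andP[s0 s1]; elim: k => [|k IH]; first by rewrite mul0r subr0 expr0.
rewrite exprS -natr1; apply: (@le_trans _ _ ((1 - s) * (1 - k%:R * s))).
  by have : 0 <= k%:R * s * s; [rewrite !mulr_ge0 | lra].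
by apply: ler_wpM2l => //; lra.
Qed.

(** Take a prime just above [y / (1 + s) ^ 10] with [s = e / 10]; then
    [1 - e <= (1 - s) ^ 10 <= (1 + s) ^ -10]. *)
Lemma prime_near_below (e : R) : 0 < e < 1 -> exists y0 : R, forall y, y0 <= y ->
  exists p, [/\ prime p, (1 - e) * y <= p%:R & p%:R <= y].
Proof.
move=> /andP[e0 e1]; pose s := e / 10.
have s0 : 0 < s by rewrite /s; lra.
have s1 : s <= 1 / 10 by rewrite /s; lra.
have [x0 Hx0] := prime_in_short_interval s0 s1.
have l0 : 0 < (1 + s) ^+ 10 by apply: exprn_gt0; lra.
exists (Num.max 0 ((1 + s) ^+ 10 * x0)) => y; rewrite ge_max => /andP[y0 yx0].
have [|p [pp /andP[p1 p2]]] := Hx0 (y / (1 + s) ^+ 10).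
  by rewrite ler_pdivlMr // mulrC.
exists p; split => //; last by move: p2; rewrite mulrC divfK // gt_eqF.
apply: le_trans (ltW p1); rewrite mulrC ler_wpM2l //.
rewrite -[X in _ <= X]mul1r ler_pdivlMr //.
apply: (@le_trans _ _ ((1 - s) ^+ 10 * (1 + s) ^+ 10)).
  rewrite ler_pM2r //; have s1' : s <= 1 by rewrite /s; lra.
  have := @bernoulli_le s 10; rewrite (ltW s0) s1' => /(_ isT).
  by rewrite /s mulrCA mulfV ?mulr1 // pnatr_eq0.
rewrite -exprMn exprn_ile1 //; rewrite /s in s0 *; nra.
Qed.

End PrimesNearBelow.

Section Scale.
Variables (R : realType) (j : nat).
Hypothesis j2 : (2 <= j)%N.

(* The scale [y] for which [n = y ^ (2 j - 1)]; then [n `^ a = y ^ (j + 1)] and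
   the target exponent gives [y ^ (2 j)]. *)
Definition scale (n : nat) : R := n%:R `^ (j.*2.-1%:R)^-1.

Lemma j_gt0 : 0 < (j.*2.-1%:R : R).
Proof. by rewrite ltr0n; lia. Qed.

Lemma j_double : j.*2.-1%:R = 2 * j%:R - 1 :> R.
Proof.
have -> : (2 * j%:R = j.*2%:R :> R) by rewrite -mul2n natrM.
by rewrite -subn1 natrB //; lia.
Qed.

Lemma scaleX n k : scale n ^+ k = n%:R `^ (k%:R / (2 * j%:R - 1)).
Proof. by rewrite /scale -powR_mulrn ?powR_ge0 // -powRrM mulrC j_double. Qed.

Lemma scale_nat n : scale n ^+ j.*2.-1 = n%:R.
Proof. by rewrite scaleX -j_double mulfV ?powRr1 // gt_eqF // j_gt0. Qed.

Lemma scale_a n : scale n ^+ j.+1 = n%:R `^ ((j%:R + 1) / (2 * j%:R - 1)).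
Proof. by rewrite scaleX -natr1. Qed.

Lemma scale_target n : scale n ^+ j.*2 = n%:R `^ ((2 + 2 * ((j%:R + 1) / (2 * j%:R - 1))) / 3).
Proof.
rewrite scaleX; congr (_ `^ _); have := j_gt0; rewrite j_double => h.
rewrite -mul2n natrM; field; lra.
Qed.

Lemma scale_ge0 n : 0 <= scale n.
Proof. exact: powR_ge0. Qed.

Lemma scale_ge1 n : (0 < n)%N -> 1 <= scale n.
Proof.
move=> n0; have i0 : 0 <= (j.*2.-1%:R : R)^-1 by rewrite invr_ge0 ler0n.
have := @ge0_ler_powR R _ i0 1 n%:R.
by rewrite powR1 !nnegrE ler01 ler0n ler1n n0; apply.
Qed.

Lemma scale_large (y0 : R) : exists N, forall n, (N <= n)%N -> y0 <= scale n.
Proof.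
pose z := Num.max y0 1.
have z1 : 1 <= z by rewrite le_max lexx orbT.
exists (Num.truncn (z ^+ j.*2.-1)).+1 => n Nn.
have zn : z ^+ j.*2.-1 <= n%:R.
  apply: ltW; apply: lt_le_trans (truncnS_gt _) _; by rewrite ler_nat.
apply: (@le_trans _ _ z); first by rewrite le_max lexx.
have j0 : (0 < j.*2.-1)%N by lia.
rewrite -(@ler_pXn2r _ j.*2.-1) ?nnegrE ?scale_ge0 ?scale_nat //; lra.
Qed.

End Scale.

(** * The two bounds in terms of the scale *)

Section Turan.
Variables (R : realType) (t j : nat).
Hypotheses (t2 : (2 <= t)%N) (j2 : (2 <= j)%N).
Local Notation a := ((j%:R + 1) / (2 * j%:R - 1) : R).
Local Notation forbidden := (fun H => H = cycle_graph 4 \/ H = theta_graph 3 t).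
Local Notation scale := (scale R j).

Definition turan (n : nat) : nat := ex_bip n (Num.truncn (n%:R `^ a)) forbidden.

Lemma turan_lower (e : R) : (j <= 'C(t + 1, 2))%N -> 0 < e < 1 -> exists N, forall n, (N <= n)%N ->
  (1 - e) * scale n ^+ j.*2 <= (turan n)%:R.
Proof.
move=> jt; have t0 : (0 < t)%N by apply: ltnW.
have jE1 : (j.-1.+1.*2 = j.*2)%N by lia.
have jE2 : (j.-1.*2.+1 = j.*2.-1)%N by lia.
have jE3 : (j.-1.+2 = j.+1)%N by lia.
move=> /andP[e0 e1].
(* By Bernoulli's inequality a prime of at least [(1 - d) * scale n] has a power [2 j] that loses
   only the factor [1 - e]. *)
pose d := e / j.*2%:R.
have jj : 1 <= j.*2%:R :> R by rewrite ler1n; lia.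
have jj0 : 0 < j.*2%:R :> R by lra.
have d0 : 0 < d by rewrite divr_gt0.
have de : d <= e by rewrite ler_pdivrMr // ler_peMr // ltW.
have dj : j.*2%:R * d = e by rewrite mulrC divfK // gt_eqF.
have [|y0 Hy0] := @prime_near_below R d; first by rewrite d0; lra.
have [N HN] := scale_large j2 y0; exists N => n /HN/Hy0[p [pp p1 p2]].
have s0 := scale_ge0 R j n.
apply: (@le_trans _ _ (p ^ j.*2)%:R).
  rewrite natrX; apply: (@le_trans _ _ (((1 - d) * scale n) ^+ j.*2)).
    rewrite exprMn; apply: ler_wpM2r; first exact: exprn_ge0.
    by rewrite -dj; apply: bernoulli_le; rewrite (ltW d0); lra.
  by rewrite lerXn2r ?nnegrE ?mulr_ge0 //; lra.
rewrite ler_nat /turan.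
have [f Hf] : exists f : 'rV['F_p]_j.-1 -> 'F_p, line_degree_between f t.
  by apply: line_degree_form => //; rewrite -(addn1 t) (leq_trans _ jt) // prednK // ltnW.
have := @ex_bip_linear_representation p t j.-1 pp f Hf n (Num.truncn (n%:R `^ a)) t0.
rewrite jE1 jE2 jE3; apply.
  by rewrite -(ler_nat R) natrX -(scale_nat R j2 n) lerXn2r ?nnegrE.
rewrite truncn_ge_nat ?powR_ge0 // natrX -(scale_a R j2).
by rewrite lerXn2r ?nnegrE.
Qed.

Lemma turan_upper (e : R) : 0 < e -> exists N, forall n, (N <= n)%N ->
  (turan n)%:R <= ((t%:R - 1) `^ 3^-1 + e) * scale n ^+ j.*2.
Proof.
have t0 : (0 < t)%N by apply: ltnW.
have jE : (j.*2 * 3 = (j.*2.-1 + j.+1) * 2)%N by lia.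
have jE2 : j.*2 = j.*2.-1.+1 by lia.
have jle : (j.+1 <= j.*2.-1)%N by lia.
move=> e0.
have t1 : 1 <= t%:R - 1 :> R.
  by have : 2 <= t%:R :> R; [rewrite ler_nat | lra].
set c := (t%:R - 1) `^ 3^-1.
have c0 : 0 < c by apply: powR_gt0; lra.
have c3 : c ^+ 3 = t%:R - 1.
  by rewrite /c -powR_mulrn ?powR_ge0 // -powRrM mulVf ?powRr1 //; lra.
pose D := (c + e / 2) ^+ 3.
have cD : c ^+ 3 < D by rewrite /D ltrXn2r ?nnegrE //; lra.
(* Since [(1 - 1 / K) ^ 2 >= 1 - 2 / K], it suffices that [K >= 2 * D / (D - c ^ 3)]; the offset
   also ensures [K >= 2]. *)
pose K := (Num.truncn (2 * D / (D - c ^+ 3))).+2.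
have KD : c ^+ 3 <= (1 - K%:R^-1) ^+ 2 * D.
  have K0 : 0 < K%:R :> R by rewrite ltr0n.
  have := truncnS_gt (2 * D / (D - c ^+ 3)).
  rewrite ltr_pdivrMr ?subr_gt0 // => HK.
  have : 2 * D <= K%:R * (D - c ^+ 3).
    apply: ltW; apply: lt_le_trans HK _; rewrite ler_pM2r ?subr_gt0 // ler_nat //.
  have iK : K%:R^-1 * K%:R = 1 :> R by rewrite mulVf // gt_eqF.
  have i0 : 0 < K%:R^-1 :> R by rewrite invr_gt0.
  have c30 : 0 < c ^+ 3 by apply: exprn_gt0.
  move: (K%:R^-1) iK i0 => v iK i0 H.
  have : v * (2 * D) <= v * (K%:R * (D - c ^+ 3)) by rewrite ler_pM2l.
  rewrite [v * (K%:R * _)]mulrA iK mul1r; have : 0 <= v ^+ 2 * D by rewrite mulr_ge0 ?sqr_ge0 //; lra.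
  rewrite !expr2; lra.
(* From [4 * K / e] on, the low-degree edges, at most [2 * K * y ^ (2 j - 1)], fit into the
   remaining [e / 2 * y ^ (2 j)]. *)
have [N HN] := scale_large j2 (4 * K%:R / e).
exists (maxn N 1) => n; rewrite geq_max => /andP[/HN sK n0].
have s1 := scale_ge1 R j n0; have s0 := scale_ge0 R j n.
set y := scale n in s1 s0 sK *.
have y0 : 0 < y by lra.
have W0 : 0 < y ^+ j.*2 by apply: exprn_gt0.
have Z0 : 0 <= (c + e) * y ^+ j.*2 by rewrite mulr_ge0 // ltW //; lra.
suff : (turan n <= Num.truncn ((c + e) * y ^+ j.*2))%N.
  by rewrite truncn_ge_nat.
rewrite /turan /ex_bip; apply/bigmax_leqP => k /asboolP[G [[A [An Am bip]] free <-]].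
rewrite truncn_ge_nat //.
have noC4 : ~ subgraph (cycle_graph 4) G by apply: free; left.
have noT : ~ subgraph (theta_graph 3 t) G by apply: free; right.
have X0 : 0 < (c + e / 2) * y ^+ j.*2 by rewrite mulr_gt0 //; lra.
have m_le : #|~: A|%:R <= y ^+ j.+1.
  by rewrite Am (scale_a R j2) truncn_le powR_ge0.
have nE : #|A|%:R = y ^+ j.*2.-1 by rewrite An (scale_nat R j2).
have := @cross_bound G A bip R t K _ t0 isT X0 noC4 noT.
have -> : t.-1%:R = c ^+ 3 by rewrite c3 -subn1 natrB.
move=> H; apply: le_trans (H _) _.
  rewrite exprMn -/D [X in _ <= X]mulrA; apply: ler_pM => //.
    by rewrite exprn_ge0 // ltW.
  have -> : (y ^+ j.*2) ^+ 3 = (y ^+ j.*2.-1 * y ^+ j.+1) ^+ 2.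
    by rewrite -exprD -!exprM jE.
  rewrite natrM lerXn2r ?nnegrE ?mulr_ge0 ?exprn_ge0 //.
  by rewrite nE ler_wpM2l ?exprn_ge0.
have yy : y ^+ j.*2 = y ^+ j.*2.-1 * y by rewrite -exprSr -jE2.
have mn : y ^+ j.+1 <= y ^+ j.*2.-1 by rewrite ler_weXn2l.
have : K%:R * (#|A| + #|~: A|)%:R <= e / 2 * y ^+ j.*2.
  rewrite natrD nE yy; apply: (@le_trans _ _ (K%:R * (2 * y ^+ j.*2.-1))).
    by rewrite ler_wpM2l ?ler0n //; lra.
  have -> : e / 2 * (y ^+ j.*2.-1 * y) = y ^+ j.*2.-1 * (e * y / 2) by ring.
  have -> : K%:R * (2 * y ^+ j.*2.-1) = y ^+ j.*2.-1 * (K%:R * 2) by ring.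
  rewrite ler_wpM2l ?exprn_ge0 //; move: sK; rewrite ler_pdivrMr //; lra.
lra.
Qed.

End Turan.

Local Open Scope classical_set_scope.
Local Open Scope ring_scope.

Theorem theorem1p6 (R : realType) (t j : nat)
    (ht : (2 <= t)%N) (hj2 : (2 <= j)%N) (hj : (j <= 'C(t + 1, 2))%N) :
  let a : R := (j%:R + 1) / (2 * j%:R - 1) in
  let turan (n : nat) : nat :=
    ex_bip n (Num.truncn (n%:R `^ a))
      (fun H => H = cycle_graph 4 \/ H = theta_graph 3 t) in
  exists eps1 eps2 : R^nat,
    [/\ eps1 @ \oo --> (0 : R),
        eps2 @ \oo --> (0 : R)
      & forall n : nat, (0 < n)%N ->
          (1 - eps1 n) * n%:R `^ ((2 + 2 * a) / 3) <= (turan n)%:R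
          <= ((t%:R - 1) `^ 3^-1 + eps2 n) * n%:R `^ ((2 + 2 * a) / 3)].
Proof.
move=> a turan'; pose W n := n%:R `^ ((2 + 2 * a) / 3) : R.
pose c := (t%:R - 1) `^ 3^-1 : R.
have WE n : W n = scale R j n ^+ j.*2 by rewrite (scale_target R hj2).
have W0 n : (0 < n)%N -> 0 < W n by move=> n0; apply: powR_gt0; rewrite ltr0n.
(* Both errors are the positive parts of the actual deviations, so the inequalities hold for every
   positive [n] and only convergence needs the bounds. *)
exists (fun n => Num.max 0 (1 - (turan' n)%:R / W n)).
exists (fun n => Num.max 0 ((turan' n)%:R / W n - c)); split.
- apply/cvgrPdist_le => e e0.
  have d0 : 0 < Num.min e 2^-1 < 1.
    by rewrite lt_min e0 gt_min invf_lt1 // ltr1n orbT invr_gt0 ltr0n.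
  have [N HN] := turan_lower ht hj2 hj d0.
  exists (maxn N 1) => // n /=; rewrite geq_max => /andP[/HN H n0].
  rewrite sub0r normrN ger0_norm ?le_max ?lexx // ge_max (ltW e0) /=.
  rewrite lerBlDl -lerBlDr ler_pdivlMr ?W0 // WE; apply: le_trans H.
  rewrite ler_wpM2r ?exprn_ge0 ?scale_ge0 // lerD2l lerN2.
  by rewrite ge_min lexx.
- apply/cvgrPdist_le => e e0.
  have [N HN] := turan_upper ht hj2 e0.
  exists (maxn N 1) => // n /=; rewrite geq_max => /andP[/HN H n0].
  rewrite sub0r normrN ger0_norm ?le_max ?lexx // ge_max (ltW e0) /=.
  by rewrite lerBlDl ler_pdivrMr ?W0 // WE.
move=> n n0; rewrite -/(W n) -/c; apply/andP; split.
  rewrite -ler_pdivlMr ?W0 //; have : 1 - (turan' n)%:R / W n <= Num.max 0 (1 - (turan' n)%:R / W n).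
    by rewrite le_max lexx orbT.
  lra.
rewrite -ler_pdivrMr ?W0 //; have : (turan' n)%:R / W n - c <= Num.max 0 ((turan' n)%:R / W n - c).
  by rewrite le_max lexx orbT.
lra.
Qed.
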